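(* Let $d\ge 1$, let $M$ be a compact metric space, $f:M\to M$ a map preserving a Borel probability measure $\nu$, $\tau:M\to\mathbb{Z}^d$ measurable, $X=M\times\mathbb{Z}^d$, $\mu=\nu\times(\text{counting measure on }\mathbb{Z}^d)$, and $T(y,z)=(f(y),z+\tau(y))$ on $X$. Let $\tilde T:X\to X$ preserve a measure $\tilde\mu$ such that for any $\varepsilon>0$ there is $\delta=\delta(\varepsilon)>0$ such that for every box $V=M\times(z+(-\lfloor w/2\rfloor,w-\lfloor w/2\rfloor]^d)$ with $z\in\mathbb{Z}^d$, $w\in\mathbb{Z}_+$ and $w<|z_i|\delta$ for all $i$, $$\sup_V\frac{d\tilde\mu}{d\mu}\le(1+\varepsilon)\inf_V\frac{d\tilde\mu}{d\mu}.$$ Suppose that there are a class $\mathfrak M$ of probability measures on $X$ and, for each $\varepsilon>0$, a class $\mathfrak M_\varepsilon$ of probability measures on $M$ such that the following hold. (M1) $\tilde T$ preserves $\mathfrak M$ (i.e. $\tilde T_*\mathfrak m\in\mathfrak M$ for $\mathfrak m\in\mathfrak M$). (M2) For each compactly supported Lipschitz function $\phi$ on $X$ and each $\varepsilon>0$ there are finitely many functions $\phi_1,\dots,\phi_k\in L^\infty(X)\cap L^1(\tilde\mu)$ supported on the unit neighborhood of the support of $\phi$ and constants $c_1,\dots,c_k$ such that $\|\phi-\sum_{j=1}^kc_j\phi_j\|_\infty\le\varepsilon$ and $\phi_j\tilde\mu\in\mathfrak M$ for each $j$. (M3) For each $\varepsilon>0$ and $n\in\mathbb{N}$ there is $R>0$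 such that for each $\mathfrak m\in\mathfrak M$, $\mathfrak m(x:|z(x)|\ge R\text{ and }d(T^nx,\tilde T^nx)\ge\varepsilon)\le\varepsilon$. (M4) There are positive $L_n\to\infty$ and a bounded continuous $p:\mathbb{R}^d\to[0,\infty)$ with $\int p=1$ such that for each $\varepsilon>0$, each $\phi\in C(M)$, each $K$ and each $\mathbb{Z}^d$-valued sequence $z_n$, $$L_n^d\int_M\phi(f^ny)\mathbf 1_{\tau_n(y)=z_n}\,d\mathfrak m(y)-p(z_n/L_n)\nu(\phi)\to0\quad(n\to\infty),$$ and the convergence is uniform for $\mathfrak m\in\mathfrak M_\varepsilon$ and $|z_n|/L_n\le K$. (M5) There is a constant $C<\infty$ such that for each $\mathfrak m\in\mathfrak M$ and each $\varepsilon>0$ there is $n_0=n_0(\mathfrak m,\varepsilon)$ such that for all $n\ge n_0$ there is a decomposition $\tilde T^n_*\mathfrak m=\sum_j(c_j'\mathfrak m_j'+c_j''\mathfrak m_j'')$, with $c_j',c_j''\ge0$ and $\mathfrak m_j',\mathfrak m_j''$ probability measures supported on $M\times\{j\}$, $j\in\mathbb{Z}^d$, such that for all $j$, $\mathfrak m_j'$ viewed as a measure on $M$ belongs to $\mathfrak M_\varepsilon$, and $\sum_jc_j''\le C\varepsilon$. (M6) For each $\mathfrak m\in\mathfrak M$ and each $R>0$, $\mathfrak m(x:|z(\tilde T^nx)|\le R)\to0$ as $n\to\infty$. Then $\tilde T$ is local global mixing with respect to $\mathbb{G}_U$.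
   Context: Notation: $z(x)$ is the $\mathbb{Z}^d$-coordinate of $x\in X$; $\tau_n(y)=\sum_{j=0}^{n-1}\tau(f^j(y))$; $d(\cdot,\cdot)$ is the product metric on $X$ ($\mathbb{Z}^d$ discrete). The measure $\tilde\mu$ is assumed to have a positive finite density with respect to $\mu$ and to be finite on bounded sets. Cubes: a cube with center $z\in\mathbb{Z}^d$ and size $w\in\mathbb{Z}_+$ is $V=M\times\big((z+(-\lfloor w/2\rfloor,w-\lfloor w/2\rfloor]^d)\cap\mathbb{Z}^d\big)$. $\mathbb{G}_U$: bounded uniformly continuous $\Phi:X\to\mathbb{R}$ for which there is $\bar\Phi\in\mathbb{R}$ such that for each $\varepsilon>0$ there is $N_0$ such that every cube $V$ of size greater than $N_0$ satisfies $\big|\frac1{\mu(V)}\int_V\Phi\,d\mu-\bar\Phi\big|\le\varepsilon$ (under the density condition on $\tilde\mu$, using $\tilde\mu$ in place of $\mu$ gives the same notion). Local global mixing of $\tilde T$ with respect to $\mathbb{G}_U$: for every $\phi\in L^1(\tilde\mu)$ and $\Phi\in\mathbb{G}_U$, $$\lim_{n\to\infty}\int\phi(x)\Phi(\tilde T^nx)\,d\tilde\mu(x)=\Big(\int\phi\,d\tilde\mu\Big)\bar\Phi.$$ *)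

(* Defs.v *)
From HB Require Import structures.
From mathcomp Require Import all_boot all_order all_algebra.
From mathcomp Require Import all_classical all_reals all_analysis.

Set Implicit Arguments.
Unset Strict Implicit.
Unset Printing Implicit Defensive.

Import Order.TTheory GRing.Theory Num.Theory.
Import numFieldNormedType.Exports.

Local Open Scope classical_set_scope.
Local Open Scope ring_scope.

HB.mixin Record hasBorelMeasurable disp (R : numDomainType) T
    & Metric R T & Measurable disp T := {
  borel_measurableE : @measurable disp T = <<s @open T >>
}.

#[short(type="borelMetricType")]
HB.structure Definition BorelMetric disp (R : numDomainType) :=
  { T of Metric R T & Measurable disp T & hasBorelMeasurable disp R T }.

(* The max metric, whose balls are those of the product pseudometric. *)
Section prod_metric.
Context (R : realFieldType) (M N : metricType R).

Definition prod_mdist (x y : M * N) : R :=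
  Num.max (mdist x.1 y.1) (mdist x.2 y.2).

Let prod_mdist_ge0 x y : 0 <= prod_mdist x y.
Proof. by rewrite le_max mdist_ge0. Qed.

Let prod_mdist_positivity x y : prod_mdist x y = 0 -> x = y.
Proof.
case: x y => [x1 x2] [y1 y2]; rewrite /prod_mdist /= => xy0.
have : mdist x1 y1 <= 0 by rewrite -xy0 le_max lexx.
have : mdist x2 y2 <= 0 by rewrite -xy0 le_max lexx orbT.
move=> h2 h1; congr (_, _); apply: mdist_positivity; apply/eqP.
  by rewrite eq_le h1 mdist_ge0.
by rewrite eq_le h2 mdist_ge0.
Qed.

Let prod_ballEmdist x e : ball x e = [set y | prod_mdist x y < e].
Proof.
apply/seteqP; split => y; rewrite /ball /= /prod_ball !ballEmdist /= /prod_mdist.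
  by case=> h1 h2; rewrite gt_max h1.
by rewrite gt_max => /andP[].
Qed.

HB.instance Definition _ := @PseudoMetric_isMetric.Build R (M * N)%type
  prod_mdist prod_mdist_ge0 prod_mdist_positivity prod_ballEmdist.

End prod_metric.

Definition Zd (d : nat) : Type := 'rV[int]_d.

HB.instance Definition _ d := GRing.Zmodule.copy (Zd d) 'rV[int]_d.
HB.instance Definition _ d := Countable.copy (Zd d) 'rV[int]_d.
HB.instance Definition _ d := isPointed.Build (Zd d) 0.
HB.instance Definition _ d := hasNbhs.Build (Zd d) principal_filter.
HB.instance Definition _ d := Discrete_ofNbhs.Build (Zd d) erefl.
HB.instance Definition _ d := DiscreteUniform_ofNbhs.Build (Zd d).

(* [discrete_ball] puts distinct points at infinite distance; here they are at
   distance 1. *)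
Section Zd_metric.
Context (R : numFieldType) (d : nat).

Definition Zd_dist (x y : Zd d) : R := (x != y)%:R.

Definition Zd_ball (x : Zd d) (e : R) : set (Zd d) := [set y | Zd_dist x y < e].

Let Zd_ball_center x e : 0 < e -> Zd_ball x e x.
Proof. by rewrite /Zd_ball /= /Zd_dist eqxx. Qed.

Let Zd_ball_sym x y e : Zd_ball x e y -> Zd_ball y e x.
Proof. by rewrite /Zd_ball /= /Zd_dist eq_sym. Qed.

Let Zd_ball_triangle x y z e1 e2 :
  Zd_ball x e1 y -> Zd_ball y e2 z -> Zd_ball x (e1 + e2) z.
Proof.
rewrite /Zd_ball /= => h1 h2; apply: le_lt_trans (ltrD h1 h2).
rewrite /Zd_dist; have [->|_] := eqVneq x y; first by rewrite add0r.
by rewrite -natrD ler_nat; case: (x != z).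
Qed.

Let Zd_entourageE : entourage = entourage_ Zd_ball.
Proof.
rewrite predeqE => P; rewrite uniform_discrete; split.
  move=> entP; exists 1 => //= z; rewrite /Zd_ball /= /Zd_dist.
  have [z12|_] := eqVneq z.1 z.2; last by rewrite ltxx.
  by move=> _; apply: entP; exists z.1 => //; rewrite {2}z12 -surjective_pairing.
move=> [e /= e0 sP] _ [x _ <-]; apply: sP => /=.
exact: Zd_ball_center.
Qed.

HB.instance Definition _ := @Uniform_isPseudoMetric.Build R (Zd d) Zd_ball
  Zd_ball_center Zd_ball_sym Zd_ball_triangle Zd_entourageE.

Let Zd_dist_ge0 x y : 0 <= Zd_dist x y.
Proof. exact: ler0n. Qed.

Let Zd_dist_positivity x y : Zd_dist x y = 0 -> x = y.
Proof. by rewrite /Zd_dist; case: eqVneq => // _ /eqP; rewrite oner_eq0. Qed.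

HB.instance Definition _ := @PseudoMetric_isMetric.Build R (Zd d)
  Zd_dist Zd_dist_ge0 Zd_dist_positivity (fun _ _ => erefl).

End Zd_metric.

HB.instance Definition _ d := @isMeasurable.Build default_measure_display
  (Zd d) discrete_measurable discrete_measurable0
  discrete_measurableC discrete_measurableU.

Section counting_Zd.
Context (R : realType) (d : nat).

Definition counting_Zd : set (Zd d) -> \bar R := @counting (Zd d) R.

HB.instance Definition _ := Measure.copy counting_Zd (@counting (Zd d) R).

Let counting_Zd_sigma_finite : sigma_finite [set: Zd d] counting_Zd.
Proof.
exists (fun n => [set z : Zd d | pickle z = n]).
  by apply/seteqP; split => // z _; exists (pickle z).
move=> n; split => //; rewrite /counting_Zd /counting asboolT ?ltry//.
have [[z zn]|h] := pselect (exists z : Zd d, pickle z = n).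
  apply: (sub_finite_set _ (finite_set1 z)) => y /= yn.
  by apply: (pcan_inj pickleK); rewrite yn.
by apply: (sub_finite_set _ (finite_set0 _)) => y /= yn; apply: h; exists y.
Qed.

HB.instance Definition _ :=
  Measure_isSigmaFinite.Build _ _ _ counting_Zd counting_Zd_sigma_finite.

End counting_Zd.

(* Lebesgue measure on R^n, carried by n-tuples: the n-fold product of the
   one-dimensional Lebesgue measure. *)
Section cons_measure.
Local Open Scope ereal_scope.
Context (R : realType) (n : nat).
Context (m : {sigma_finite_measure set (n.-tuple R) -> \bar R}).

Definition tuple_cons (x : R * n.-tuple R) : n.+1.-tuple R :=
  [tuple of x.1 :: x.2].

Let measurable_tuple_cons : measurable_fun [set: R * n.-tuple R] tuple_cons.
Proof. exact: measurable_cons. Qed.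

Definition cons_measure : set (n.+1.-tuple R) -> \bar R :=
  pushforward (@lebesgue_measure R \x m) tuple_cons.

Let cons_measure0 : cons_measure set0 = 0.
Proof. by rewrite /cons_measure /pushforward preimage_set0 measure0. Qed.

Let cons_measure_ge0 A : 0 <= cons_measure A.
Proof. exact: integral_ge0. Qed.

Let cons_measure_sigma_additive : semi_sigma_additive cons_measure.
Proof.
move=> F mF tF mUF; rewrite /cons_measure /pushforward preimage_bigcup.
have mpre A : measurable A -> measurable (tuple_cons @^-1` A).
  by move=> mA; rewrite -[X in measurable X]setTI; exact: measurable_tuple_cons.
apply: measure_semi_sigma_additive.
- by move=> k; exact: mpre.
- apply/trivIsetP => /= i j _ _ ij; rewrite -preimage_setI.
  by move/trivIsetP : tF => /(_ _ _ _ _ ij) ->//; rewrite preimage_set0.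
- by rewrite -preimage_bigcup; exact: mpre.
Qed.

HB.instance Definition _ := isMeasure.Build _ _ _ cons_measure
  cons_measure0 cons_measure_ge0 cons_measure_sigma_additive.

Let cons_measure_sigma_finite : sigma_finite [set: n.+1.-tuple R] cons_measure.
Proof.
have /sigma_finiteP[F [TF ndF Foo]] := sigma_finiteT (@lebesgue_measure R).
have /sigma_finiteP[G [TG ndG Goo]] := sigma_finiteT m.
pose H k := [set t : n.+1.-tuple R | F k (thead t) /\ G k [tuple of behead t]].
have HE k : H k = (fun t => thead t) @^-1` F k `&`
    (fun t : n.+1.-tuple R => [tuple of behead t]) @^-1` G k by [].
exists H.
  apply/seteqP; split => // t _.
  have [i _ Fi] : (\bigcup_k F k) (thead t) by rewrite -TF.
  have [j _ Gj] : (\bigcup_k G k) [tuple of behead t] by rewrite -TG.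
  exists (maxn i j) => //; split.
    by move: Fi; apply/subsetPset/ndF/leq_maxl.
  by move: Gj; apply/subsetPset/ndG/leq_maxr.
move=> k; have [mF Fk] := Foo k; have [mG Gk] := Goo k; split.
  rewrite HE; apply: measurableI.
    by rewrite -[X in measurable X]setTI; exact: (measurable_tnth ord0).
  by rewrite -[X in measurable X]setTI; exact: measurable_behead.
rewrite /cons_measure /pushforward.
have -> : tuple_cons @^-1` H k = F k `*` G k.
  apply/funext => -[x t]; rewrite /preimage /H /mkset /=.
  have -> : [tuple of behead (tuple_cons (x, t))] = t by exact: val_inj.
  by [].
rewrite product_measure1E//.
by rewrite lte_mul_pinfty// ge0_fin_numE.
Qed.

HB.instance Definition _ :=
  Measure_isSigmaFinite.Build _ _ _ cons_measure cons_measure_sigma_finite.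

End cons_measure.

Fixpoint lebesgue_tuple (R : realType) (n : nat) :
    {sigma_finite_measure set (n.-tuple R) -> \bar R} :=
  match n with
  | 0 => \d_([tuple] : 0.-tuple R)
  | n'.+1 => cons_measure (lebesgue_tuple R n')
  end.

Definition Zd_to_rV (R : realType) (d : nat) (z : Zd d) : 'rV[R]_d :=
  map_mx intr (z : 'rV[int]_d).

(* The norm of ['rV[R]_d] is the max norm. *)
Definition Zd_norm (R : realType) (d : nat) (z : Zd d) : R := `|Zd_to_rV R z|.

(* Elements of [C] only matter through their values on measurable sets, so a
   set function belongs to the class [C] when it agrees with some element of
   [C] on all measurable sets. *)
Definition in_class disp (T : measurableType disp) (R : realType)
    (C : set (probability T R)) (m : set T -> \bar R) : Prop :=
  exists2 m' : probability T R, C m' & forall A, measurable A -> m' A = m A.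

Definition preserves disp (T : measurableType disp) (R : realType)
    (m : set T -> \bar R) (F : T -> T) : Prop :=
  measurable_fun [set: T] F /\
  forall A, measurable A -> pushforward m F A = m A.

Section metric_functions.
Context (R : realType) (X : metricType R).
Implicit Types (phi : X -> R) (S : set X).

Definition support_closure phi : set X := closure [set x | phi x != 0].

Definition lipschitz_fun phi : Prop :=
  exists K : R, forall x y, `|phi x - phi y| <= K * mdist x y.

Definition unit_neighborhood S : set X :=
  [set x | exists2 y, S y & mdist x y < 1].

Definition bounded_function phi : Prop :=
  exists B : R, forall x, `|phi x| <= B.

End metric_functions.

Section skew_products.
Context (R : realType) (disp : measure_display) (M : borelMetricType disp R).
Context (d : nat).
Local Notation X := (M * Zd d)%type.

Definition nu_counting (nu : probability M R) : {measure set X -> \bar R} :=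
  (nu \x @counting_Zd R d)%E.

Definition birkhoff_sum (f : M -> M) (tau : M -> Zd d) (n : nat) (y : M)
    : Zd d :=
  \sum_(j < n) tau (iter j f y).

Definition skew_product (f : M -> M) (tau : M -> Zd d) (x : X) : X :=
  (f x.1, x.2 + tau x.1).

Definition cube (z : Zd d) (w : nat) : set X :=
  [set x : X | forall i : 'I_d,
    z 0 i - (w./2)%:Z < x.2 0 i <= z 0 i + (w - w./2)%N%:Z].

(* Boundedness refers to the norm of Z^d: every subset of X is bounded for the
   product metric, as distinct points of Z^d are at distance 1. *)
Definition finite_on_bounded (m : set X -> \bar R) : Prop :=
  forall A : set X, measurable A ->
  (exists r : R, forall x, A x -> Zd_norm R x.2 <= r) -> (m A < +oo)%E.

(* [h] is an everywhere positive version of the density dm/dmu. *)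
Definition positive_density (mu m : {measure set X -> \bar R}) (h : X -> R)
    : Prop :=
  [/\ measurable_fun [set: X] h,
      forall x, 0 < h x
    & forall A, measurable A -> m A = (\int[mu]_(x in A) (h x)%:E)%E].

Definition slowly_varying (h : X -> R) : Prop :=
  forall eps : R, 0 < eps -> exists2 delta : R, 0 < delta &
  forall (z : Zd d) (w : nat),
    (forall i : 'I_d, w%:R < `|z 0 i|%:~R * delta) ->
    (ereal_sup [set (h x)%:E | x in cube z w] <=
     (1 + eps)%:E * ereal_inf [set (h x)%:E | x in cube z w])%E.

Definition cube_average (mu : {measure set X -> \bar R}) (Phi : X -> R)
    (V : set X) : R :=
  (fine (mu V))^-1 * \int[mu]_(x in V) Phi x.

Definition global_average (mu : {measure set X -> \bar R}) (Phi : X -> R)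
    (Phibar : R) : Prop :=
  forall eps : R, 0 < eps -> exists N0 : nat,
  forall (z : Zd d) (w : nat), (N0 < w)%N ->
    `|cube_average mu Phi (cube z w) - Phibar| <= eps.

Definition GU (mu : {measure set X -> \bar R}) : set (X -> R) :=
  [set Phi | [/\ bounded_function Phi,
                 unif_continuous (Phi : X -> R^o)
               & exists Phibar, global_average mu Phi Phibar]].

(* [mu] only serves to define the global observables and their averages. *)
Definition local_global_mixing (mu m : {measure set X -> \bar R}) (F : X -> X)
    : Prop :=
  forall (phi Phi : X -> R) (Phibar : R),
    m.-integrable [set: X] (EFin \o phi) ->
    GU mu Phi -> global_average mu Phi Phibar ->
    (fun n => \int[m]_x (phi x * Phi (iter n F x))) @ \oo -->
      (\int[m]_x phi x) * Phibar.

End skew_products.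

(* Main.v *)
Require Import Defs.
From HB Require Import structures.
From mathcomp Require Import all_boot all_order all_algebra.
From mathcomp Require Import all_classical all_reals all_analysis.
From mathcomp Require Import measurable_realfun ess_sup_inf.
From mathcomp Require Import zify ring lra.

Set Implicit Arguments.
Unset Strict Implicit.
Unset Printing Implicit Defensive.

Import Order.TTheory GRing.Theory Num.Theory.
Import numFieldNormedType.Exports.

Local Open Scope classical_set_scope.
Local Open Scope ring_scope.

(** Both sides of the convergence are linear in [phi], so it suffices to control
    the integrals of [phi * (Phi o Tt^n - Phibar)].  Since [Phi] is bounded,
    these change little when [phi] changes little in [L^1(mut)].  Compactly
    supported Lipschitz functions are dense there ([lipschitz_dense]), and each
    of them is, up to a small error in [L^oo] on a set of finite measure, a
    combination of densities of laws of the class [MM].  It remains to prove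
    that the integral of [Phi o Tt^n] against a law [m] of [MM] converges to
    [Phibar] ([class_mixing]).

    Write [n = q + N], with [q] fixed and large and [N] tending to infinity.
    The law [mN] of [Tt^N] under [m] is again in [MM], and it escapes to
    infinity; far away, [q] steps of [Tt] stay close to [q] steps of the skew
    product [T], so that, [Phi] being uniformly continuous, the integral of
    [Phi o Tt^q] against [mN] is close to that of [Phi o T^q].  Now [mN]
    decomposes along the slices [M x {j}] into laws of the class [MMeps], up to
    a small mass ([decomposition_bound]), and what is needed is that the
    integral of [Phi (f^q y, j + tau_q y)] against a law of [MMeps] is close to
    [Phibar], uniformly in the law and in [j] ([local_mixing_uniform]).

    A partition of unity of [M] replaces the functions [Phi (., k)] by
    combinations of finitely many continuous functions, to which the local
    limit theorem applies with a common rate.  With a continuous cutoff of [p]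
    at radius [K], it turns the integral into the weighted sum of
    [p (z / L_q) / L_q^d * nu (Phi (., j + z))] over [|z| <= (K + 1) L_q]
    ([local_limit_estimate]).  The weights have total mass close to [1], as
    Riemann sums of [p] ([riemann_sum_cvg], [cutoff_mass]); this also bounds
    the mass lost in the cutoff.  They vary slowly, so averaging the sum over
    the translations by the points of a fixed large cube replaces
    [nu (Phi (., k))] by its averages over cubes ([shift_average]), which are
    close to [Phibar]. *)

(** * Integrals of finite sums and of bounded functions *)

Section finite_sums.
Context d (T : measurableType d) (R : realType).
Variable m : {measure set T -> \bar R}.

Lemma integrable_EFin_sum I (s : seq I) (F : I -> T -> R) :
  (forall i, m.-integrable [set: T] (EFin \o F i)) ->
  m.-integrable [set: T] (EFin \o (fun x => \sum_(i <- s) F i x)).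
Proof.
move=> iF; have := integrable_sum measurableT s (fun i (_ : true) => iF i).
apply: eq_integrable => // x _ /=.
by rewrite sumEFin.
Qed.

Lemma Rintegral_sum I (s : seq I) (F : I -> T -> R) :
  (forall i, m.-integrable [set: T] (EFin \o F i)) ->
  \int[m]_x (\sum_(i <- s) F i x) = \sum_(i <- s) \int[m]_x F i x.
Proof.
move=> iF; elim: s => [|i s ih].
  under eq_Rintegral do rewrite big_nil.
  by rewrite big_nil Rintegral_cst// mul0r.
under eq_Rintegral do rewrite big_cons.
by rewrite RintegralD// ?ih ?big_cons//; exact: integrable_EFin_sum.
Qed.

Lemma integrable_EFin_indic (A : set T) (c : R) :
  measurable A -> (m A < +oo)%E ->
  m.-integrable [set: T] (EFin \o (fun x => c * \1_A x)).
Proof.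
move=> mA mAoo.
have i1 : m.-integrable [set: T] (EFin \o (\1_A : T -> R)).
  apply/integrableP; split.
    by apply/measurable_EFinP; exact: measurable_indic.
  under eq_integral do rewrite /= ger0_norm ?ler0n//.
  by rewrite integral_indic// setIT.
by have := integrableZl measurableT c i1; apply.
Qed.

Lemma Rintegral_indic (A : set T) (c : R) :
  measurable A -> (m A < +oo)%E -> \int[m]_x (c * \1_A x) = c * fine (m A).
Proof.
move=> mA mAoo; have i1 := integrable_EFin_indic 1 mA mAoo.
rewrite RintegralZl//; first by rewrite /Rintegral integral_indic// setIT.
by move: i1; apply: eq_integrable => // x _ /=; rewrite mul1r.
Qed.

End finite_sums.

Section bounded_functions.
Context d (T : measurableType d) (R : realType).
Implicit Types (F G : T -> R) (B : R).

(** Bounded measurable functions: the test functions integrated against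
    probability measures below. *)
Definition bounded_measurable F : Prop :=
  measurable_fun [set: T] F /\ exists B, forall x, `|F x| <= B.

Lemma bounded_measurable_cst c : bounded_measurable (cst c).
Proof. by split=> //; exists `|c|. Qed.

Lemma bounded_measurable_indic (A : set T) :
  measurable A -> bounded_measurable \1_A.
Proof.
move=> mA; split; first exact: measurable_indic.
exists 1 => x; rewrite indicE; case: (_ \in _); rewrite ?normr1 ?normr0//.
Qed.

Lemma bounded_measurableD F G : bounded_measurable F ->
  bounded_measurable G -> bounded_measurable (fun x => F x + G x).
Proof.
move=> [mF [B FB]] [mG [C GC]]; split; first exact: measurable_funD.
by exists (B + C) => x; rewrite (le_trans (ler_normD _ _))// lerD.
Qed.

Lemma bounded_measurableM F G : bounded_measurable F ->
  bounded_measurable G -> bounded_measurable (fun x => F x * G x).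
Proof.
move=> [mF [B FB]] [mG [C GC]]; split; first exact: measurable_funM.
by exists (B * C) => x; rewrite normrM ler_pM.
Qed.

Lemma bounded_measurableZ c F : bounded_measurable F ->
  bounded_measurable (fun x => c * F x).
Proof. exact: bounded_measurableM (bounded_measurable_cst c). Qed.

Lemma bounded_measurableB F G : bounded_measurable F ->
  bounded_measurable G -> bounded_measurable (fun x => F x - G x).
Proof.
move=> [mF [B FB]] [mG [C GC]]; split; first exact: measurable_funB.
by exists (B + C) => x; rewrite (le_trans (ler_normB _ _))// lerD.
Qed.

Lemma bounded_measurable_norm F : bounded_measurable F ->
  bounded_measurable (fun x => `|F x|).
Proof.
move=> [mF [B FB]]; split; first exact: measurableT_comp.
by exists B => x; rewrite normr_id.
Qed.

Lemma bounded_measurable_sum I (s : seq I) (F_ : I -> T -> R) :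
  (forall i, bounded_measurable (F_ i)) ->
  bounded_measurable (fun x => \sum_(i <- s) F_ i x).
Proof.
move=> bF; elim: s => [|i s ih].
  under eq_fun do rewrite big_nil; exact: bounded_measurable_cst.
under eq_fun do rewrite big_cons; exact: bounded_measurableD.
Qed.

(** Induction principle for bounded measurable functions: such a function is a
    uniform limit of the simple functions obtained by rounding its values down to a multiple of a small step. *)
Lemma bounded_measurable_ind (P : (T -> R) -> Prop) :
  (forall A, measurable A -> P \1_A) ->
  P (cst 0) ->
  (forall F G, bounded_measurable F -> bounded_measurable G ->
    P F -> P G -> P (fun x => F x + G x)) ->
  (forall c F, bounded_measurable F -> P F -> P (fun x => c * F x)) ->
  (forall F, bounded_measurable F -> (forall eps : R, 0 < eps ->
    exists G, [/\ bounded_measurable G, P G & forall x, `|F x - G x| <= eps]) ->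
    P F) ->
  forall F, bounded_measurable F -> P F.
Proof.
move=> Pindic P0 PD PZ Plim F bF; have [mF [B FB]] := bF.
apply: Plim => // eps eps0.
(* The values of F / eps lie in [-N, N), and A k is the event that their
   integer part is k - N. *)
pose N := `|Num.ceil (B / eps)|%N.+1.
have NB x : F x / eps < N%:R /\ - N%:R <= F x / eps.
  have Be : B / eps <= N.-1%:R.
    rewrite /N/= natr_absz (le_trans (ceil_ge _))// ler_int ler_norm//.
  have := FB x; rewrite ler_norml => /andP[FB1 FB2].
  have h1 : F x / eps <= B / eps by rewrite ler_pM2r ?invr_gt0.
  have h2 : - (B / eps) <= F x / eps by rewrite -mulNr ler_pM2r ?invr_gt0.
  have NS : N.-1%:R < N%:R :> R by rewrite ltr_nat.
  split; first by lra.
  by lra.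
pose A (k : nat) := [set x | Num.floor (F x / eps) = k%:Z - N%:Z].
have mA k : measurable (A k).
  have -> : A k = (fun x => F x / eps) @^-1`
      [set` `[(k%:Z - N%:Z)%:~R, (k%:Z - N%:Z + 1)%:~R[%R].
    apply/seteqP; split => x; rewrite /A /= in_itv /=.
      by move=> <-; rewrite floor_le floorD1_gt.
    by move=> h; apply/floor_def.
  rewrite -[X in measurable X]setTI.
  have mFe : measurable_fun [set: T] (fun x => F x / eps).
    exact: measurable_funM.
  exact: mFe.
pose G x := \sum_(k <- iota 0 (N + N)) (k%:R - N%:R) * eps * \1_(A k) x.
have bG k : bounded_measurable (fun x => (k%:R - N%:R) * eps * \1_(A k) x).
  exact/bounded_measurableZ/bounded_measurable_indic.
exists G; split.
- exact: bounded_measurable_sum.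
- rewrite /G; elim: (iota _ _) => [|k s ih].
    by under eq_fun do rewrite big_nil.
  under eq_fun do rewrite big_cons.
  apply: PD => //; first exact: bounded_measurable_sum.
  by apply: PZ; [exact: bounded_measurable_indic|exact: Pindic].
move=> x; have [NB1 NB2] := NB x.
pose z := Num.floor (F x / eps).
have zN : (- N%:Z <= z)%R by rewrite /z floor_ge_int rmorphN.
have zN' : (z < N%:Z)%R by rewrite /z floor_lt_int.
pose k := absz (z + N%:Z).
have kE : k%:Z = z + N%:Z by rewrite /k gez0_abs//; lia.
have -> : G x = z%:~R * eps.
  rewrite /G (bigD1_seq k) ?iota_uniq//; last first.
    rewrite mem_iota leq0n add0n andTb; lia.
  rewrite big1 => [|j jk].
    rewrite /= addr0 indicE mem_set ?mulr1; last by rewrite /A/= -/z kE addrK.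
    by congr (_ * _); rewrite !pmulrn -intrB kE addrK.
  rewrite indicE memNset ?mulr0// /A/= -/z => zj.
  by case/eqP : jk; apply/eqP; rewrite -eqz_nat kE zj subrK.
have := floor_itv (F x / eps); have := floorD1_gt (F x / eps).
rewrite -/z ler_pdivlMr// ltr_pdivrMr// intrD => h1 h2.
rewrite ler_norml; apply/andP; split; first by lra.
by move: h1; rewrite mulrDl mul1r; lra.
Qed.

Variable m : probability T R.

Lemma bounded_measurable_integrable F : bounded_measurable F ->
  m.-integrable [set: T] (EFin \o F).
Proof.
move=> [mF [B FB]]; apply: measurable_bounded_integrable => //.
  by rewrite (le_lt_trans (probability_le1 m _)) ?ltry.
exists B; split; first exact: num_real.
by move=> C BC x _; exact: le_trans (FB x) (ltW BC).
Qed.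

Lemma prob_Rintegral_cst c : \int[m]_x cst c x = c.
Proof. by rewrite Rintegral_cst// [X in fine X]probability_setT /= mulr1. Qed.

Lemma prob_Rintegral_le_norm F B : bounded_measurable F ->
  (forall x, `|F x| <= B) -> `|\int[m]_x F x| <= B.
Proof.
move=> bF FB; apply: (le_trans (le_normr_Rintegral _ _)) => //.
  exact: bounded_measurable_integrable.
rewrite -[leRHS]prob_Rintegral_cst; apply: le_Rintegral => //.
- exact/bounded_measurable_integrable/bounded_measurable_norm.
- exact/bounded_measurable_integrable/bounded_measurable_cst.
Qed.

Lemma bounded_RintegralD F G : bounded_measurable F -> bounded_measurable G ->
  \int[m]_x (F x + G x) = \int[m]_x F x + \int[m]_x G x.
Proof. by move=> bF bG; rewrite RintegralD//; exact: bounded_measurable_integrable. Qed.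

Lemma bounded_RintegralB F G : bounded_measurable F -> bounded_measurable G ->
  \int[m]_x (F x - G x) = \int[m]_x F x - \int[m]_x G x.
Proof. by move=> bF bG; rewrite RintegralB//; exact: bounded_measurable_integrable. Qed.

Lemma bounded_RintegralZl F c : bounded_measurable F ->
  \int[m]_x (c * F x) = c * \int[m]_x F x.
Proof. by move=> bF; rewrite RintegralZl//; exact: bounded_measurable_integrable. Qed.

Lemma bounded_Rintegral_sum I (s : seq I) (F_ : I -> T -> R) :
  (forall i, bounded_measurable (F_ i)) ->
  \int[m]_x (\sum_(i <- s) F_ i x) = \sum_(i <- s) \int[m]_x F_ i x.
Proof.
by move=> bF; apply: Rintegral_sum => i; exact: bounded_measurable_integrable.
Qed.

Lemma prob_Rintegral_indic (A : set T) : measurable A ->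
  \int[m]_x \1_A x = fine (m A).
Proof. by move=> mA; rewrite /Rintegral integral_indic// setIT. Qed.

Lemma le_prob_Rintegral F G : bounded_measurable F -> bounded_measurable G ->
  (forall x, F x <= G x) -> \int[m]_x F x <= \int[m]_x G x.
Proof.
by move=> bF bG FG; apply: le_Rintegral => //; exact: bounded_measurable_integrable.
Qed.

Lemma prob_Rintegral_dist F G B : bounded_measurable F -> bounded_measurable G ->
  (forall x, `|F x - G x| <= B) -> `|\int[m]_x F x - \int[m]_x G x| <= B.
Proof.
move=> bF bG FG; rewrite -bounded_RintegralB//.
by apply: prob_Rintegral_le_norm => //; exact: bounded_measurableB.
Qed.

End bounded_functions.

Lemma bounded_measurable_comp d d' (T : measurableType d) (T' : measurableType d')
    (R : realType) (F : T' -> R) (g : T -> T') :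
  measurable_fun [set: T] g -> bounded_measurable F ->
  bounded_measurable (F \o g).
Proof.
move=> mg [mF [B FB]]; split; first exact: measurableT_comp.
by exists B => x; exact: FB.
Qed.

Lemma bounded_Rintegral_pushforward d d' (T : measurableType d)
    (T' : measurableType d') (R : realType) (m : probability T R)
    (m' : probability T' R) (g : T -> T') (F : T' -> R) :
  measurable_fun [set: T] g ->
  (forall A, measurable A -> m' A = pushforward m g A) ->
  bounded_measurable F -> \int[m']_x F x = \int[m]_x F (g x).
Proof.
move=> mg m'E bF; rewrite /Rintegral; congr fine.
pose g' : {mfun T >-> T'} := mfun_Sub (mem_set mg).
rewrite (eq_measure_integral (pushforward m g')); last first.
  by move=> A mA _; exact: m'E.
rewrite integral_pushforward//.
- have [mF _] := bF; exact/measurable_EFinP.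
- have := bounded_measurable_integrable m (bounded_measurable_comp mg bF).
  by [].
Qed.

(** * Measurability on the product with [Z^d] *)

Section Zd_product.
Context (R : realType) (disp : measure_display) (M : borelMetricType disp R).
Context (d : nat).
Local Notation X := (M * Zd d)%type.

Lemma measurable_Zd_pair (A : set (Zd d * Zd d)) : measurable A.
Proof.
have -> : A = \bigcup_z (if z \in A then [set z.1] `*` [set z.2] else set0).
  apply/seteqP; split => [z Az|z [z' _]].
    by exists z => //; rewrite mem_set.
  case: ifPn => // /set_mem; case: z' => a b Az [/= h1 h2].
  by move: Az; rewrite -h1 -h2; case: z {h1 h2}.
apply: countable_bigcupT_measurable; first exact: countableP.
by move=> z; case: ifP => // _; exact: measurableX.
Qed.

Lemma countable_Zd (A : set (Zd d)) : countable A.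
Proof. exact: sub_countable (subset_card_le (@subsetT _ A)) (countableP _). Qed.

Lemma measurable_slice (A : set (Zd d)) : measurable [set x : X | A x.2].
Proof.
have -> : [set x : X | A x.2] = [set: M] `*` A.
  by apply/seteqP; split => x //= [].
exact: measurableX.
Qed.

(** As [Z^d] is countable, measurability on the product is measurability on
    every slice. *)
Lemma measurable_fun_slices d' (T : measurableType d') (F : X -> T) :
  (forall k, measurable_fun [set: M] (fun y => F (y, k))) ->
  measurable_fun [set: X] F.
Proof.
move=> mF _ B mB; rewrite setTI.
have -> : F @^-1` B = \bigcup_(k in [set: Zd d])
    (((fun y => F (y, k)) @^-1` B) `*` [set k]).
  apply/seteqP; split => [[y k] /= Fyk|[y k] [k' _] [/= ? ->]//].
  by exists k.
apply: countable_bigcupT_measurable; first exact: countable_Zd.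
move=> k; apply: measurableX => //.
by rewrite -[X in measurable X]setTI; exact: mF.
Qed.

Lemma open_measurable_borel (U : set M) : open U -> measurable U.
Proof. by move=> oU; rewrite borel_measurableE; exact: sub_sigma_algebra. Qed.

Lemma continuous_measurable_borel (g : M -> R) :
  continuous g -> measurable_fun [set: M] g.
Proof.
move=> /continuousP cg; apply: (measurability _ (RGenOpens.measurableE R)).
move=> _ [_ [a [b ->]] <-]; apply: measurableI => //.
by apply: open_measurable_borel; apply: cg; exact: interval_open.
Qed.

Lemma mdist_continuous (T : metricType R) (x : T) :
  continuous (mdist x : T -> R).
Proof.
move=> y; apply/cvgrPdist_lt => e e0.
have := nbhsx_ballx y _ e0; apply: filterS => z; rewrite ballEmdist /= => yz.
have h1 := metric_triangle x y z; have h2 := metric_triangle x z y.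
have h3 := metric_sym y z.
by rewrite ltr_norml; apply/andP; split; lra.
Qed.

Lemma compact_finite_net : compact [set: M] ->
  forall e : R, 0 < e ->
  exists s : seq M, forall y, exists2 x, x \in s & mdist x y < e.
Proof.
move=> cM e e0; move: cM; rewrite compact_cover.
move=> /(_ M setT (fun x => (ball x e)°)) [||D _ DM].
- by move=> x _; exact: open_interior.
- by move=> y _; exists y => //; exact: nbhsx_ballx.
exists (finmap.enum_fset D) => y; have [x Dx /interior_subset] := DM y I.
by rewrite ballEmdist /= => xy; exists x.
Qed.

(** The distance between two measurable maps is measurable: in a separable
    space, [mdist u v < e] is witnessed by a point of a countable dense set. *)
Lemma measurable_mdist_lt d' (T : measurableType d') (u v : T -> M) (e : R) :
  compact [set: M] -> measurable_fun [set: T] u -> measurable_fun [set: T] v ->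
  measurable [set t | mdist (u t) (v t) < e].
Proof.
move=> cM mu mv.
have /choice[s sP] : forall n : nat, exists s : seq M,
    forall y, exists2 x, x \in s & mdist x y < n.+1%:R^-1.
  by move=> n; exact: compact_finite_net.
pose g x t := mdist x (u t) + mdist x (v t).
have mg x : measurable_fun [set: T] (g x).
  apply: measurable_funD; apply: (measurableT_comp (continuous_measurable_borel _)) => //;
  exact: mdist_continuous.
have -> : [set t | mdist (u t) (v t) < e] =
    \bigcup_n \bigcup_(x in [set` s n]) [set t | g x t < e].
  apply/seteqP; split => [t /= uve|t [n _ [x _]] /=]; last first.
    apply: le_lt_trans; rewrite /g (metric_sym x (u t)).
    exact: metric_triangle.
  pose n := Num.truncn (2 / (e - mdist (u t) (v t))).
  have [x xs xu] := sP n (u t).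
  exists n => //; exists x => //=.
  have h1 := metric_triangle x (u t) (v t); rewrite /g.
  have : 2 * n.+1%:R^-1 < e - mdist (u t) (v t).
    rewrite ltr_pdivrMr// mulrC -ltr_pdivrMr ?subr_gt0//.
    exact: truncnS_gt.
  by move: h1 xu; set a := n.+1%:R^-1; lra.
apply: bigcup_measurable => n _; apply: fin_bigcup_measurable => //.
move=> x _; have := mg x measurableT _ (measurable_itv `]-oo, e[).
by rewrite setTI; congr (measurable _).
Qed.

Lemma measurable_mdist_ge d' (T : measurableType d') (u v : T -> X) (e : R) :
  compact [set: M] -> measurable_fun [set: T] u -> measurable_fun [set: T] v ->
  measurable [set t | e <= mdist (u t) (v t)].
Proof.
move=> cM mu mv.
have -> : [set t | e <= mdist (u t) (v t)] =
    ~` ([set t | mdist (u t).1 (v t).1 < e] `&`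
        [set t | mdist (u t).2 (v t).2 < e]).
  apply/seteqP; split => t /=.
    by move=> h [h1 h2]; move: h; rewrite leNgt gt_max h1 h2.
  by move=> h; rewrite leNgt; apply/negP; rewrite gt_max => /andP[h1 h2]; exact: h.
apply: measurableC; apply: measurableI.
  by apply: measurable_mdist_lt => //; exact: measurableT_comp.
have -> : [set t | mdist (u t).2 (v t).2 < e] =
   (fun t => ((u t).2, (v t).2)) @^-1` [set z | mdist z.1 z.2 < e] by [].
rewrite -[X in measurable X]setTI.
have : measurable_fun [set: T] (fun t => ((u t).2, (v t).2)).
  by apply: measurable_fun_pair; exact: measurableT_comp.
apply => //.
exact: measurable_Zd_pair.
Qed.

Lemma unif_continuous_dist (T : metricType R) (Phi : T -> R) :
  unif_continuous (Phi : T -> R^o) ->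
  forall e : R, 0 < e -> exists2 delta : R, 0 < delta &
    forall x y, mdist x y < delta -> `|Phi x - Phi y| < e.
Proof.
move=> /unif_continuousP uPhi e e0; have [delta d0 h] := uPhi e e0.
exists delta => // x y xy; have := h (x, y); rewrite /= ballEmdist; exact.
Qed.

Lemma dist_slice (y y' : M) (k : Zd d) :
  mdist ((y, k) : X) (y', k) = mdist y y'.
Proof.
rewrite [LHS]/(Num.max (mdist y y') (mdist k k)) mdistxx.
by apply/max_idPl; exact: mdist_ge0.
Qed.

Lemma unif_continuous_slice (Phi : X -> R) (k : Zd d) :
  unif_continuous (Phi : X -> R^o) -> continuous (fun y => Phi (y, k)).
Proof.
move=> /unif_continuous_dist uPhi y; apply/cvgrPdist_lt => e e0.
have [delta d0 h] := uPhi _ e0.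
have := nbhsx_ballx y _ d0; apply: filterS => z; rewrite ballEmdist /= => yz.
by apply: h; rewrite dist_slice.
Qed.

Lemma unif_continuous_measurable (Phi : X -> R) :
  unif_continuous (Phi : X -> R^o) -> measurable_fun [set: X] Phi.
Proof.
move=> uPhi; apply: measurable_fun_slices => k.
by apply: continuous_measurable_borel; exact: unif_continuous_slice.
Qed.

Lemma measurable_iter d' (T : measurableType d') (g : T -> T) n :
  measurable_fun [set: T] g -> measurable_fun [set: T] (iter n g).
Proof.
by move=> mg; elim: n => [|n ih]; [exact: measurable_id|exact: measurableT_comp].
Qed.

Lemma measurable_birkhoff_sum (f : M -> M) (tau : M -> Zd d) n :
  measurable_fun [set: M] f -> measurable_fun [set: M] tau ->
  measurable_fun [set: M] (birkhoff_sum f tau n).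
Proof.
move=> mf mtau; elim: n => [|n ih].
  by rewrite /birkhoff_sum; under eq_fun do rewrite big_ord0; exact: measurable_cst.
rewrite /birkhoff_sum; under eq_fun do rewrite big_ord_recr/=.
have madd : measurable_fun [set: (Zd d * Zd d)%type] (fun z => z.1 + z.2).
  by move=> _ B _; exact: measurable_Zd_pair.
apply: (measurableT_comp madd (g := fun y => (birkhoff_sum f tau n y, tau (iter n f y)))).
apply: measurable_fun_pair => //.
by apply: measurableT_comp => //; exact: measurable_iter.
Qed.

Lemma iter_skew_product (f : M -> M) (tau : M -> Zd d) n (x : X) :
  iter n (skew_product f tau) x = (iter n f x.1, x.2 + birkhoff_sum f tau n x.1).
Proof.
elim: n => [|n ih]; first by case: x => y k; rewrite /birkhoff_sum big_ord0 addr0.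
by rewrite iterS ih /skew_product /= /birkhoff_sum big_ord_recr/= addrA.
Qed.

End Zd_product.

(** * Density of compactly supported Lipschitz functions in [L^1] *)

Section distance_to_set.
Context (R : realType) (T : metricType R).

(** Distance to a set, meaningful only for nonempty sets. *)
Definition dist_to (F : set T) (y : T) : R := inf [set mdist x y | x in F].

Lemma dist_to_lb (F : set T) y : has_lbound [set mdist x y | x in F].
Proof. by exists 0 => _ [x _ <-]; exact: mdist_ge0. Qed.

Lemma dist_to_ge0 (F : set T) y : F !=set0 -> 0 <= dist_to F y.
Proof.
move=> [x Fx]; apply: lb_le_inf; first by exists (mdist x y), x.
by move=> _ [z _ <-]; exact: mdist_ge0.
Qed.

Lemma dist_to_mem (F : set T) y : F y -> dist_to F y = 0.
Proof.
move=> Fy; apply/eqP; rewrite eq_le dist_to_ge0 ?andbT; last by exists y.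
by apply: ge_inf; [exact: dist_to_lb|exists y => //; rewrite mdistxx].
Qed.

Lemma dist_to_lip (F : set T) y z : F !=set0 ->
  dist_to F y <= dist_to F z + mdist y z.
Proof.
move=> F0; rewrite -lerBlDr; apply: lb_le_inf.
  by case: F0 => x Fx; exists (mdist x z), x.
move=> _ [x Fx <-]; rewrite lerBlDr.
apply: (@le_trans _ _ (mdist x y)).
  by apply: ge_inf; [exact: dist_to_lb|exists x].
by rewrite (metric_sym y); exact: metric_triangle.
Qed.

Lemma dist_to_gt0 (U : set T) y : open U -> U y -> ~` U !=set0 ->
  0 < dist_to (~` U) y.
Proof.
move=> oU Uy U0; have /nbhs_ballP[e /= e0 eU] := open_nbhs_nbhs (conj oU Uy).
apply: (lt_le_trans e0); apply: lb_le_inf.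
  by case: U0 => x Ux; exists (mdist x y), x.
move=> _ [x Ux <-]; rewrite leNgt; apply/negP => xy; apply: Ux.
by apply: eU; rewrite ballEmdist /= metric_sym.
Qed.

(** For each [n], an [n]-Lipschitz function with values in [0, 1]; these
    functions converge to the indicator of the open set [U].  The distance to
    the complement is meaningless when [U] is the whole space, where the
    constant function [1] is used. *)
Definition open_approx (U : set T) (n : nat) (y : T) : R :=
  if pselect (~` U !=set0) then Num.min 1 (n%:R * dist_to (~` U) y) else 1.

Lemma open_approx_itv U n y : 0 <= open_approx U n y <= 1.
Proof.
rewrite /open_approx; case: pselect => [U0|U0]/=; last by rewrite ler01 lexx.
by rewrite ge_min lexx le_min ler01 mulr_ge0// dist_to_ge0.
Qed.

Lemma open_approx_lip U n y z :
  `|open_approx U n y - open_approx U n z| <= n%:R * mdist y z.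
Proof.
rewrite /open_approx; case: pselect => [U0|U0]/=; last first.
  by rewrite subrr normr0 mulr_ge0// mdist_ge0.
have h1 : n%:R * dist_to (~` U) y <= n%:R * dist_to (~` U) z + n%:R * mdist y z.
  by rewrite -mulrDr ler_wpM2l//; exact: dist_to_lip.
have h2 : n%:R * dist_to (~` U) z <= n%:R * dist_to (~` U) y + n%:R * mdist y z.
  by rewrite -mulrDr ler_wpM2l// (metric_sym y); exact: dist_to_lip.
have h3 : 0 <= n%:R * mdist y z by rewrite mulr_ge0// mdist_ge0.
move: (n%:R * dist_to _ y) (n%:R * dist_to _ z) (n%:R * mdist y z) h1 h2 h3.
move=> a b c h1 h2 h3; rewrite ler_norml; apply/andP.
by have [h4|h4] := leP 1 a; have [h5|h5] := leP 1 b; split; lra.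
Qed.

Lemma open_approx_cvg U y : open U ->
  open_approx U ^~ y @ \oo --> (\1_U y : R).
Proof.
move=> oU; rewrite /open_approx; case: pselect => [U0|U0]/=; last first.
  rewrite indicE mem_set; first exact: cvg_cst.
  by apply: contrapT => Uy; apply: U0; exists y.
rewrite indicE; have [/set_mem Uy|/negP Uy] := boolP (y \in U).
  have d0 := dist_to_gt0 oU Uy U0.
  apply: cvg_near_cst; near=> n; apply/min_idPl.
  rewrite -ler_pdivrMr//.
  by near: n; exact: nbhs_infty_ger.
rewrite dist_to_mem; last by move=> Uy'; apply: Uy; rewrite mem_set.
under eq_fun do rewrite mulr0 (min_idPr _)//.
exact: cvg_cst.
Unshelve. all: by end_near. Qed.

End distance_to_set.

Section density.
Context (R : realType) (disp : measure_display) (M : borelMetricType disp R).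
Context (d : nat).
Local Notation X := (M * Zd d)%type.
Hypothesis M_compact : compact [set: M].
Variable m : {measure set X -> \bar R}.
Hypothesis m_bounded : finite_on_bounded m.

(** The closure in [L^1(m)] of the integrable, compactly supported Lipschitz
    functions. *)
Definition L1_closure (phi : X -> R) : Prop :=
  m.-integrable [set: X] (EFin \o phi) /\
  forall e : R, 0 < e -> exists psi : X -> R,
    [/\ lipschitz_fun psi, compact (support_closure psi),
        m.-integrable [set: X] (EFin \o psi) &
        (\int[m]_x `|phi x - psi x|%:E <= e%:E)%E].

Lemma compact_slice (k : Zd d) : compact [set x : X | x.2 = k].
Proof.
have -> : [set x : X | x.2 = k] = [set: M] `*` [set k].
  by apply/seteqP; split => x //= [].
by apply: compact_setX => //; exact: compact_set1.
Qed.

Lemma compact_support (psi : X -> R) (K : set X) : compact K ->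
  (forall x, psi x != 0 -> K x) -> compact (support_closure psi).
Proof.
move=> cK psiK; apply: (subclosed_compact _ cK); first exact: closed_closure.
have -> : K = closure K.
  by apply/closure_id; apply: compact_closed cK; exact: metric_hausdorff.
by apply: closureS => x; exact: psiK.
Qed.

Lemma measure_slice_fin (k : Zd d) : (m [set x : X | x.2 = k] < +oo)%E.
Proof.
apply: m_bounded; first exact: (@measurable_slice R disp M d [set k]).
by exists (Zd_norm R k) => x /= ->.
Qed.

Lemma integrable_dist (phi psi : X -> R) :
  m.-integrable [set: X] (EFin \o phi) -> m.-integrable [set: X] (EFin \o psi) ->
  m.-integrable [set: X] (fun x => `|phi x - psi x|%:E).
Proof.
move=> iphi ipsi.
have := integrable_abse (integrableB measurableT iphi ipsi).
by [].
Qed.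

Lemma integrable_EFinD (phi psi : X -> R) :
  m.-integrable [set: X] (EFin \o phi) -> m.-integrable [set: X] (EFin \o psi) ->
  m.-integrable [set: X] (EFin \o (fun x => phi x + psi x)).
Proof.
by move=> iphi ipsi; have := integrableD measurableT iphi ipsi; apply.
Qed.

Lemma integrable_EFinZ (c : R) (phi : X -> R) :
  m.-integrable [set: X] (EFin \o phi) ->
  m.-integrable [set: X] (EFin \o (fun x => c * phi x)).
Proof. by move=> iphi; have := integrableZl measurableT c iphi; apply. Qed.

Lemma L1_closure_lim (phi : X -> R) : m.-integrable [set: X] (EFin \o phi) ->
  (forall e : R, 0 < e -> exists psi, L1_closure psi /\
    (\int[m]_x `|phi x - psi x|%:E <= e%:E)%E) -> L1_closure phi.
Proof.
move=> iphi hphi; split => // e e0.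
have e2 : 0 < e / 2 by rewrite divr_gt0.
have [psi [[ipsi hpsi] phipsi]] := hphi _ e2.
have [xi [lxi cxi ixi psixi]] := hpsi _ e2.
exists xi; split => //.
have -> : e%:E = ((e / 2)%:E + (e / 2)%:E)%E by rewrite -EFinD -splitr.
apply: le_trans (leeD phipsi psixi).
rewrite -integralD//; [|exact: integrable_dist..].
apply: ge0_le_integral => //.
- exact: measurable_int (integrable_dist iphi ixi).
- by apply: emeasurable_funD; exact: measurable_int (integrable_dist _ _).
- by move=> x Dx; rewrite -EFinD lee_fin; exact: ler_distD.
Qed.

Lemma L1_closure_dominated (phi_ : nat -> X -> R) (phi : X -> R)
    (g : X -> \bar R) :
  (forall n, L1_closure (phi_ n)) -> measurable_fun [set: X] phi ->
  (forall x, phi_ ^~ x @ \oo --> phi x) ->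
  m.-integrable [set: X] g ->
  (forall x n, (`|phi_ n x|%:E <= g x)%E) ->
  L1_closure phi.
Proof.
move=> cphi mphi phi_cvg ig gphi.
have h1 x : setT x -> (EFin \o phi_ ^~ x) @ \oo --> (phi x)%:E.
  move=> _; apply: cvg_EFin; first exact: nearW.
  exact: phi_cvg.
have h2 x n : setT x -> (`|(phi_ n x)%:E| <= g x)%E by move=> _; exact: gphi.
have mphi_ n : measurable_fun [set: X] (EFin \o phi_ n).
  exact: measurable_int (cphi n).1.
have mphi' : measurable_fun [set: X] (EFin \o phi) by exact/measurable_EFinP.
have [iphi h _] := dominated_convergence measurableT mphi_ mphi' (aeW _ h1) ig
  (aeW _ h2).
apply: L1_closure_lim => // e e0.
have {}h : (fun n => fine (\int[m]_x `|(phi_ n x)%:E - (phi x)%:E|)%E) @ \oo --> (0 : R).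
  exact: (fine_cvg h).
move/cvgrPdist_lt : h => /(_ _ e0)[n _ /(_ n (leqnn n))] /=.
rewrite sub0r normrN => hn; exists (phi_ n); split => //.
have := integrable_dist iphi (cphi n).1.
under eq_integral do rewrite distrC.
under eq_fun do rewrite distrC.
move=> /integrable_fin_num -/(_ measurableT) fin.
rewrite -(fineK fin) lee_fin; apply: ltW; apply: le_lt_trans hn.
exact: ler_norm.
Qed.

Lemma L1_closure0 : L1_closure (cst 0).
Proof.
have i0 : m.-integrable [set: X] (EFin \o cst (0 : R)) by exact: integrable0.
split => // e e0; exists (cst 0); split => //.
- by exists 0 => x y; rewrite subrr normr0 mul0r.
- by apply: (compact_support (@compact0 X)) => x; rewrite eqxx.
- under eq_integral do rewrite /= subrr normr0.
  by rewrite integral0 lee_fin ltW.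
Qed.

Lemma L1_closureD phi psi : L1_closure phi -> L1_closure psi ->
  L1_closure (fun x => phi x + psi x).
Proof.
move=> [iphi hphi] [ipsi hpsi]; split; first exact: integrable_EFinD iphi ipsi.
move=> e e0; have e2 : 0 < e / 2 by rewrite divr_gt0.
have [phi' [[K lphi] cphi iphi' hphi']] := hphi _ e2.
have [psi' [[K' lpsi] cpsi ipsi' hpsi']] := hpsi _ e2.
exists (fun x => phi' x + psi' x); split.
- exists (K + K') => x y; rewrite opprD addrACA mulrDl.
  by rewrite (le_trans (ler_normD _ _))// lerD.
- apply: (compact_support (compactU cphi cpsi)) => x.
  have [->|p0] := eqVneq (phi' x) 0.
    by rewrite add0r => q0; right; exact: subset_closure.
  by move=> _; left; exact: subset_closure.
- exact: integrable_EFinD iphi' ipsi'.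
- have -> : e%:E = ((e / 2)%:E + (e / 2)%:E)%E by rewrite -EFinD -splitr.
  apply: le_trans (leeD hphi' hpsi').
  rewrite -integralD//; [|exact: integrable_dist..].
  apply: ge0_le_integral => //.
  + apply: measurable_int (integrable_dist _ _).
      exact: integrable_EFinD iphi ipsi.
    exact: integrable_EFinD iphi' ipsi'.
  + by apply: emeasurable_funD; exact: measurable_int (integrable_dist _ _).
  + move=> x Dx; rewrite -EFinD lee_fin opprD addrACA; exact: ler_normD.
Qed.

Lemma L1_closureZ (c : R) phi : L1_closure phi -> L1_closure (fun x => c * phi x).
Proof.
move=> [iphi hphi]; split; first exact: integrable_EFinZ iphi.
move=> e e0; have e1 : 0 < e / (`|c| + 1) by rewrite divr_gt0// ltr_wpDl.
have [phi' [[K lphi] cphi iphi' hphi']] := hphi _ e1.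
exists (fun x => c * phi' x); split.
- exists (`|c| * K) => x y; rewrite -mulrBr normrM -mulrA.
  by rewrite ler_wpM2l.
- apply: (compact_support cphi) => x; rewrite mulf_eq0 negb_or => /andP[_ p0].
  exact: subset_closure.
- exact: integrable_EFinZ iphi'.
under eq_integral do rewrite -mulrBr normrM EFinM.
rewrite integralZl//; last exact: integrable_dist.
apply: (@le_trans _ _ (`|c|%:E * (e / (`|c| + 1))%:E)%E).
  by rewrite lee_wpmul2l.
rewrite -EFinM lee_fin mulrCA ler_piMr ?(ltW e0)//.
by rewrite ler_pdivrMr ?ltr_wpDl// mul1r lerDl.
Qed.

(** The indicator of the slice [M x {k}]. *)
Definition slice_indic (k : Zd d) (x : X) : R := (x.2 == k)%:R.

Lemma slice_indicE k : slice_indic k = \1_[set x : X | x.2 = k].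
Proof.
apply/funext => x; rewrite /slice_indic indicE; congr (nat_of_bool _)%:R.
by apply/idP/idP => [/eqP xk|/set_mem /= ->//]; rewrite inE.
Qed.

Lemma integrable_slice k : m.-integrable [set: X] (EFin \o slice_indic k).
Proof.
have := integrable_EFin_indic 1 (@measurable_slice R disp M d [set k])
  (measure_slice_fin k).
by rewrite slice_indicE; under eq_fun do rewrite mul1r.
Qed.

Lemma measurable_slice_indic k : measurable_fun [set: X] (slice_indic k).
Proof.
rewrite slice_indicE; apply: measurable_indic.
exact: (@measurable_slice R disp M d [set k]).
Qed.

(** The bound [g <= 1] is needed because two distinct slices are at distance
    [1] from each other. *)
Lemma lipschitz_slice (g : M -> R) (K : R) k :
  (forall y, 0 <= g y <= 1) -> (forall y z, `|g y - g z| <= K * mdist y z) ->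
  lipschitz_fun (fun x : X => g x.1 * slice_indic k x).
Proof.
move=> g01 glip; exists (`|K| + 1) => -[y a] [z b] /=.
rewrite /slice_indic /=.
have -> : mdist ((y, a) : X) (z, b) = Num.max (mdist y z) (a != b)%:R by [].
have D0 : 0 <= mdist y z by exact: mdist_ge0.
have g1 := g01 y; have g2 := g01 z.
have [<-|ab] := eqVneq a b.
  rewrite (max_idPl _)// -mulrBl normrM.
  apply: (@le_trans _ _ `|g y - g z|).
    by rewrite ler_piMr//; case: (_ == _); rewrite ?normr1 ?normr0.
  apply: le_trans (glip y z) _; rewrite ler_wpM2r//.
  by rewrite (le_trans (ler_norm _))// lerDl.
apply: (@le_trans _ _ (1 * 1)); last first.
  by apply: ler_pM => //; rewrite ?lerDr// le_max lexx orbT.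
rewrite mulr1; have [ak|ak] := eqVneq a k; have [bk|bk] := eqVneq b k.
- by move: ab; rewrite ak bk eqxx.
- by rewrite mulr0 subr0 mulr1 ger0_norm; case/andP: g1.
- by rewrite mulr0 sub0r mulr1 normrN ger0_norm; case/andP: g2.
- by rewrite !mulr0 subrr normr0.
Qed.

Lemma slice_open (U : set M) k : open U ->
  L1_closure (fun x : X => \1_U x.1 * slice_indic k x).
Proof.
move=> oU.
apply: (@L1_closure_dominated
  (fun n x => open_approx U n x.1 * slice_indic k x) _ (EFin \o slice_indic k)).
- move=> n.
  have mg : measurable_fun [set: X] (fun x : X => open_approx U n x.1 * slice_indic k x).
    apply: measurable_funM; last exact: measurable_slice_indic.
    apply: measurableT_comp => //; apply: continuous_measurable_borel.
    move=> y; apply/cvgrPdist_lt => e e0.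
    have e1 : 0 < e / n.+1%:R by rewrite divr_gt0.
    have := nbhsx_ballx y _ e1; apply: filterS => z; rewrite ballEmdist /= => yz.
    apply: le_lt_trans (open_approx_lip U n y z) _.
    apply: (@le_lt_trans _ _ (n.+1%:R * mdist y z)).
      by rewrite ler_wpM2r ?mdist_ge0// ler_nat.
    by rewrite mulrC -ltr_pdivlMr.
  have ig : m.-integrable [set: X]
      (EFin \o (fun x : X => open_approx U n x.1 * slice_indic k x)).
    apply: (le_integrable measurableT _ _ (integrable_slice k)).
      exact/measurable_EFinP.
    move=> x _ /=; rewrite lee_fin normrM ler_piMl//.
    by have /andP[h1 h2] := open_approx_itv U n x.1; rewrite ger0_norm.
  split => // e e0; exists (fun x : X => open_approx U n x.1 * slice_indic k x).
  split => //.
  + apply: lipschitz_slice; first exact: open_approx_itv.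
    exact: open_approx_lip.
  + apply: (compact_support (@compact_slice k)) => x.
    by rewrite /slice_indic; case: (eqVneq x.2 k) => // _; rewrite mulr0 eqxx.
  + under eq_integral do rewrite subrr normr0.
    by rewrite integral0 lee_fin ltW.
- apply: measurable_funM; last exact: measurable_slice_indic.
  apply: measurableT_comp => //; apply: measurable_indic.
  exact: open_measurable_borel.
- by move=> x; apply: cvgMl; exact: open_approx_cvg.
- exact: integrable_slice.
- move=> x n; rewrite lee_fin normrM ger0_norm; last first.
    by have /andP[] := open_approx_itv U n x.1.
  rewrite ger0_norm; last exact: ler0n.
  by rewrite ler_piMl ?ler0n//; have /andP[] := open_approx_itv U n x.1.
Qed.

(** The sets [A] with this property contain the open sets, which are stable
    under intersection, and form a Dynkin system. *)
Lemma slice_borel (A : set M) k : measurable A ->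
  L1_closure (fun x : X => \1_A x.1 * slice_indic k x).
Proof.
rewrite borel_measurableE.
have mM : @measurable _ M = <<s @open M >> by exact: borel_measurableE.
have lT : L1_closure (slice_indic k).
  have := @slice_open setT k (@openT M); congr (L1_closure _).
  by apply/funext => x; rewrite indicT mul1r.
apply: (@dynkin_induction _ M (@open M)
  (fun A => L1_closure (fun x : X => \1_A x.1 * slice_indic k x)) mM).
- exact: openI.
- exact: slice_open openT.
- by move=> U; exact: slice_open.
- move=> S mS LS.
  have := L1_closureD lT (L1_closureZ (-1) LS); congr (L1_closure _).
  apply/funext => x; rewrite !indicE in_setC.
  by case: (x.1 \in S) => /=; lra.
- move=> F mF tF LF.
  apply: (@L1_closure_dominated
    (fun n x => \1_(\big[setU/set0]_(i < n) F i) x.1 * slice_indic k x) _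
    (EFin \o slice_indic k)).
  + elim=> [|n ih].
      have := L1_closure0; congr (L1_closure _); apply/funext => x.
      by rewrite big_ord0 indic0 mul0r.
    have := L1_closureD ih (LF n); congr (L1_closure _); apply/funext => x.
    rewrite -mulrDl; congr (_ * _).
    rewrite big_ord_recr /= !indicE in_setU -natrD; congr (_%:R).
    have [xn|] := boolP (x.1 \in F n); last by rewrite orbF addn0.
    rewrite orbT memNset// -bigcup_mkord => -[i /= ini Fix].
    have ein := tF i n I I (ex_intro _ x.1 (conj Fix (set_mem xn))).
    by move: ini; rewrite ein ltnn.
  + apply: measurable_funM; last exact: measurable_slice_indic.
    apply: measurableT_comp => //; apply: measurable_indic.
    exact: bigcup_measurable.
  + move=> x; apply: cvgMl; apply: cvg_near_cst.
    rewrite !indicE; have [/set_mem[i _ Fix]|xF] := boolP (x.1 \in _).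
      near=> n; rewrite indicE mem_set// -bigcup_mkord; exists i => //=.
      by near: n; exact: nbhs_infty_gt.
    near=> n; rewrite indicE memNset// -bigcup_mkord => -[i _ Fix].
    by move/negP: xF; apply; rewrite mem_set//; exists i.
  + exact: integrable_slice.
  + move=> x n; rewrite lee_fin normrM ger0_norm ?ler0n//.
    rewrite ger0_norm ?ler0n// ler_piMl ?ler0n//.
Unshelve. all: by end_near. Qed.

Lemma slice_bounded (F : X -> R) k : bounded_measurable F ->
  L1_closure (fun x => F x * slice_indic k x).
Proof.
move: F; apply: bounded_measurable_ind.
- move=> A mA.
  have mAk : measurable [set y | A (y, k)].
    rewrite -[X in measurable X]setTI.
    exact: (pair2_measurable k).
  have := slice_borel k mAk; congr (L1_closure _); apply/funext => -[y z].
  rewrite /slice_indic !indicE /=; have [->|_] := eqVneq z k; last by rewrite !mulr0.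
  by congr ((nat_of_bool _)%:R * _); apply/idP/idP; rewrite !inE.
- by have := L1_closure0; congr (L1_closure _); apply/funext => x; rewrite mul0r.
- move=> F G _ _ LF LG; have := L1_closureD LF LG; congr (L1_closure _).
  by apply/funext => x; rewrite mulrDl.
- move=> c F _ LF; have := L1_closureZ c LF; congr (L1_closure _).
  by apply/funext => x; rewrite mulrA.
- move=> F [mF [B FB]] h.
  have mFk : measurable_fun [set: X] (fun x => F x * slice_indic k x).
    by apply: measurable_funM => //; exact: measurable_slice_indic.
  have /choice[G GP] : forall n : nat, exists G, [/\ bounded_measurable G,
      L1_closure (fun x : X => G x * slice_indic k x)
      & forall x, `|F x - G x| <= n.+1%:R^-1].
    by move=> n; exact: h.
  apply: (@L1_closure_dominated
    (fun n x => G n x * slice_indic k x) _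
    (EFin \o (fun x => (B + 1) * slice_indic k x))) => //.
  + by move=> n; have [] := GP n.
  + move=> x; apply: cvgMl; apply/cvgrPdist_lt => e e0.
    near=> n; have [_ _ hn] := GP n.
    apply: le_lt_trans (hn x) _.
    by near: n; exact: near_infty_natSinv_lt (PosNum e0).
  + by have := integrable_EFinZ (B + 1) (integrable_slice k).
  + move=> x n; have [_ _ hn] := GP n.
    rewrite lee_fin normrM [X in _ * X]ger0_norm ?ler0n// ler_wpM2r ?ler0n//.
    have h1 := FB x; have h2 := hn x.
    have h3 : n.+1%:R^-1 <= 1 :> R by rewrite invf_le1 ?ler1n.
    rewrite -[G n x](subrK (F x)) addrC; apply: le_trans (ler_normD _ _) _.
    by rewrite lerD// distrC (le_trans h2).
Unshelve. all: by end_near. Qed.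

Lemma lipschitz_dense (phi : X -> R) :
  m.-integrable [set: X] (EFin \o phi) -> L1_closure phi.
Proof.
move=> iphi.
have mphi : measurable_fun [set: X] phi.
  by apply/measurable_EFinP; exact: measurable_int iphi.
(* Truncate both the values and, through an enumeration of Z^d, the slices. *)
pose cl (n : nat) x : R := Num.max (- n%:R) (Num.min n%:R (phi x)).
pose F n (x : X) := cl n x * (pickle x.2 < n)%:R.
have bcl n : bounded_measurable (cl n).
  split.
    apply: measurable_maxr; first exact: measurable_cst.
    by apply: measurable_minr => //; exact: measurable_cst.
  exists n%:R => x; rewrite /cl.
  have n0 : (0 : R) <= n%:R by [].
  rewrite ler_norml; have [h1|h1] := leP n%:R (phi x).
    by have [h2|h2] := leP (- n%:R) n%:R; apply/andP; split; lra.
  by have [h2|h2] := leP (- n%:R) (phi x); apply/andP; split; lra.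
apply: (@L1_closure_dominated F _ (fun x => `|phi x|%:E)) => //.
- move=> n; suff h j : L1_closure (fun x => cl n x * (pickle x.2 < j)%:R).
    exact: h.
  elim: j => [|j ih].
    by have := L1_closure0; congr (L1_closure _); apply/funext => x; rewrite mulr0.
  have [[k kj]|nk] := pselect (exists k : Zd d, pickle k = j).
    have := L1_closureD ih (slice_bounded k (bcl n)); congr (L1_closure _).
    apply/funext => x; rewrite -mulrDr -natrD; congr (_ * _%:R).
    rewrite [in RHS]ltnS [in RHS]leq_eqVlt.
    have [xk|xk] := eqVneq x.2 k; first by rewrite xk kj eqxx ltnn.
    case: eqP => [xj|_]; last by rewrite addn0.
    by move/eqP: xk; case; apply: (pcan_inj pickleK); rewrite xj.
  move: ih; congr (L1_closure _); apply/funext => x; congr (_ * _%:R).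
  rewrite [in RHS]ltnS [in RHS]leq_eqVlt; case: eqP => // xj; exfalso; apply: nk.
  by exists x.2.
- move=> x; apply: cvg_near_cst; near=> n; rewrite /F /cl.
  have h1 : `|phi x| <= n%:R by near: n; exact: nbhs_infty_ger.
  have h2 : (pickle x.2 < n)%N by near: n; exact: nbhs_infty_gt.
  move: h1; rewrite h2 mulr1 ler_norml => /andP[h1 h3].
  by rewrite (min_idPr h3) (max_idPr h1).
- exact: integrable_abse iphi.
- move=> x n; rewrite lee_fin /F normrM.
  apply: (@le_trans _ _ `|cl n x|).
    by rewrite ler_piMr// ger0_norm ?ler0n//; case: (_ < _)%N.
  rewrite /cl; have n0 : (0 : R) <= n%:R by [].
  have p1 := ler_norm (phi x); have p2 : - phi x <= `|phi x|.
    by rewrite -normrN ler_norm.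
  move: p1 p2; move: (`|phi x|) (phi x) => a p p1 p2; rewrite ler_norml.
  have [h1|h1] := leP n%:R p.
    by have [h2|h2] := leP (- n%:R) (n%:R : R); apply/andP; split; lra.
  by have [h2|h2] := leP (- n%:R) p; apply/andP; split; lra.
Unshelve. all: by end_near. Qed.

End density.

(** * Finite sums over boxes of [Z^d] *)

Section sums_over_boxes.
Context (R : realType) (d : nat).
Implicit Types (z u : Zd d) (F G : Zd d -> R).

Lemma row_norm_le (v : 'rV[R]_d) (r : R) : 0 <= r ->
  `|v| <= r <-> forall i, `|v 0 i| <= r.
Proof.
move=> r0; rewrite [`|v|]mx_normrE; split => [/bigmax_leP[_ h] i|h].
  exact: (h (0, i)).
by apply/bigmax_leP; split => // -[i j] _ /=; rewrite (ord1 i).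
Qed.

Lemma Zd_norm_le z (n : nat) :
  Zd_norm R z <= n%:R <-> forall i, (`|z 0 i| <= n%:Z)%R.
Proof.
rewrite /Zd_norm row_norm_le//; split => h i.
  by have := h i; rewrite /Zd_to_rV mxE -intr_norm -[n%:R]/(n%:Z%:~R) ler_int.
by rewrite /Zd_to_rV mxE -intr_norm -[n%:R]/(n%:Z%:~R) ler_int.
Qed.

Lemma Zd_to_rVD z u : Zd_to_rV R (z + u) = Zd_to_rV R z + Zd_to_rV R u.
Proof. by apply/rowP => i; rewrite !mxE intrD. Qed.

(** The integer points all of whose coordinates are [a + k] with [k < n]. *)
Definition zgrid (a : int) (n : nat) : seq (Zd d) :=
  [seq (\row_i (a + (g i : nat)%:Z) : Zd d) | g : {ffun 'I_d -> 'I_n}].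

Lemma mem_zgrid a n z :
  (z \in zgrid a n) <-> forall i, (a <= z 0 i < a + n%:Z)%R.
Proof.
split => [/mapP[g _ ->] i|h].
  by rewrite mxE lerDl ltrD2l ltz_nat ltn_ord.
have hn (i : 'I_d) : (`|(z 0 i - a)%R|%N < n)%N.
  by have /andP[h1 h2] := h i; lia.
apply/mapP; exists [ffun i => Ordinal (hn i)]; first by rewrite mem_enum.
apply/rowP => i; rewrite mxE ffunE /=.
by have /andP[h1 h2] := h i; lia.
Qed.

Lemma zgrid_uniq a n : uniq (zgrid a n).
Proof.
rewrite map_inj_uniq ?enum_uniq// => g g' /rowP gg'; apply/ffunP => i.
by have := gg' i; rewrite !mxE => /addrI[] /val_inj.
Qed.

Lemma size_zgrid a n : size (zgrid a n) = (n ^ d)%N.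
Proof. by rewrite size_map -cardE card_ffun !card_ord. Qed.

(** The integer points of norm at most [n], of coordinates from [- n] to [n]. *)
Definition zbox (n : nat) : seq (Zd d) := zgrid (- n%:Z) n.*2.+1.

Lemma mem_zbox n z : (z \in zbox n) <-> Zd_norm R z <= n%:R.
Proof.
rewrite Zd_norm_le mem_zgrid; split => h i; have := h i.
  by rewrite ler_norml => /andP[h1 h2]; apply/andP; split; lia.
by rewrite ler_norml => /andP[h1 h2]; apply/andP; split; lia.
Qed.

Lemma zbox_uniq n : uniq (zbox n).
Proof. exact: zgrid_uniq. Qed.

Lemma size_zbox n : size (zbox n) = (n.*2.+1 ^ d)%N.
Proof. exact: size_zgrid. Qed.

Lemma sum_eq_support (s1 s2 : seq (Zd d)) F : uniq s1 -> uniq s2 ->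
  (forall z, F z != 0 -> (z \in s1) && (z \in s2)) ->
  \sum_(z <- s1) F z = \sum_(z <- s2) F z.
Proof.
move=> u1 u2 h.
have e (s s' : seq (Zd d)) : (forall z, F z != 0 -> z \in s') ->
    \sum_(z <- s) F z = \sum_(z <- s | z \in s') F z.
  move=> hs; symmetry; apply: big_rmcond => z.
  by apply: contraNeq => /hs.
rewrite (e s1 s2) => [|z /h /andP[]//]; rewrite (e s2 s1) => [|z /h /andP[]//].
rewrite -[LHS]big_filter -[RHS]big_filter; apply: perm_big.
apply: uniq_perm; rewrite ?filter_uniq// => z.
by rewrite !mem_filter andbC.
Qed.

(** A finitely supported sum over the lattice is translation invariant. *)
Lemma sum_shift (s : seq (Zd d)) u F : uniq s ->
  (forall z, F z != 0 -> (z \in s) && (z - u \in s)) ->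
  \sum_(z <- s) F (z + u) = \sum_(z <- s) F z.
Proof.
move=> us h.
rewrite -(big_map (fun z => z + u) xpredT F).
apply: sum_eq_support => //; first by rewrite map_inj_uniq//; exact: addIr.
move=> z /h /andP[-> zu]; rewrite andbT.
by apply/mapP; exists (z - u) => //; rewrite subrK.
Qed.

Lemma sum_norm_le (s : seq (Zd d)) F (c : R) :
  (forall z, `|F z| <= c) -> `|\sum_(z <- s) F z| <= (size s)%:R * c.
Proof.
move=> h; apply: (le_trans (ler_norm_sum _ _ _)).
elim: s => [|z s ih]; first by rewrite big_nil mul0r.
by rewrite big_cons /= mulrS mulrDl mul1r lerD.
Qed.

(** Decomposing an integral along the values of a lattice-valued function [t],
    for a weight [F] supported on finitely many of them. *)
Lemma Rintegral_level_sets disp (T : measurableType disp) (m : probability T R)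
    (t : T -> Zd d) (s : seq (Zd d)) (g : T -> R) F :
  measurable_fun [set: T] t -> uniq s -> (forall z, F z != 0 -> z \in s) ->
  bounded_measurable g ->
  \int[m]_y (F (t y) * g y) =
  \sum_(z <- s) F z * \int[m]_y (g y * \1_[set y' | t y' = z] y).
Proof.
move=> mt us Fs bg.
have b1 z : bounded_measurable (\1_[set y' | t y' = z] : T -> R).
  apply: bounded_measurable_indic.
  by rewrite -[X in measurable X]setTI; exact: (mt measurableT [set z]).
have b2 z : bounded_measurable (fun y => g y * \1_[set y' | t y' = z] y).
  exact: bounded_measurableM.
under eq_bigr do rewrite -bounded_RintegralZl//.
rewrite -bounded_Rintegral_sum => [|z]; last exact: bounded_measurableZ.
apply: eq_Rintegral => y _.
have [ts|ts] := boolP (t y \in s).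
  rewrite (bigD1_seq (t y))//= big1 ?addr0 => [|z zt].
    by rewrite indicE mem_set// mulr1.
  by rewrite indicE memNset ?mulr0//= => /esym/eqP; rewrite (negbTE zt).
rewrite big1_seq => [|z /andP[_ zs]].
  have /eqP -> : F (t y) == 0 by apply: contraNT ts => /Fs.
  by rewrite mul0r.
rewrite indicE memNset ?mulr0//= => tz.
by move: ts; rewrite tz zs.
Qed.

End sums_over_boxes.

(** * Lebesgue measure of grid cells *)

Section lebesgue_cells.
Context (R : realType).

(** The index [z] of the cell of the grid of mesh [1 / L] containing a point;
    its corner is [z / L]. *)
Definition cell (d : nat) (L : R) (t : d.-tuple R) : Zd d :=
  \row_i Num.floor (L * tnth t i).

Lemma floor_preimage (L : R) (k : int) : 0 < L ->
  [set x : R | Num.floor (L * x) = k] = `[k%:~R / L, (k + 1)%:~R / L[%classic.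
Proof.
move=> L0; apply/seteqP; split => x; rewrite /= in_itv /=.
  move=> <-; rewrite ler_pdivrMr// ltr_pdivlMr// (mulrC x).
  exact: floor_itv.
rewrite ler_pdivrMr// ltr_pdivlMr// (mulrC x) => h.
exact: floor_def.
Qed.

Lemma measurable_floor (L : R) (k : int) : 0 < L ->
  measurable [set x : R | Num.floor (L * x) = k].
Proof. by move=> L0; rewrite floor_preimage//; exact: measurable_itv. Qed.

Lemma cell_preimage d (L : R) (z : Zd d) :
  [set t | cell L t = z] =
  \bigcap_(i in [set: 'I_d]) [set t | Num.floor (L * tnth t i) = z 0 i].
Proof.
apply/seteqP; split => [t /= <- i _|t h]; first by rewrite /= mxE.
by apply/rowP => i; rewrite mxE; exact: h.
Qed.

Lemma measurable_cell_preimage d (L : R) (z : Zd d) : 0 < L ->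
  measurable [set t | cell L t = z].
Proof.
move=> L0; rewrite cell_preimage; apply: fin_bigcap_measurable => // i _.
rewrite -[X in measurable X]setTI.
exact: (measurable_tnth i measurableT (measurable_floor (z 0 i) L0)).
Qed.

Lemma measurable_cell d (L : R) : 0 < L ->
  measurable_fun [set: d.-tuple R] (@cell d L).
Proof.
move=> L0 _ B _; rewrite setTI.
have -> : @cell d L @^-1` B =
    \bigcup_z (if z \in B then [set t | cell L t = z] else set0).
  apply/seteqP; split => [t Bt|t [z _]].
    by exists (cell L t) => //; rewrite mem_set.
  by case: ifPn => // /set_mem Bz tz; rewrite /= tz.
apply: countable_bigcupT_measurable; first exact: countableP.
by move=> z; case: ifP => // _; exact: measurable_cell_preimage.
Qed.

Lemma lebesgue_cell d (L : R) (z : Zd d) : 0 < L ->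
  lebesgue_tuple R d [set t | cell L t = z] = (L ^- d)%:E.
Proof.
move=> L0; elim: d z => [|d ih] z /=.
  by rewrite cell_preimage expr0 invr1 diracE mem_set// => i; case: i.
pose z' : Zd d := \row_i z 0 (lift ord0 i).
rewrite /cons_measure /pushforward.
set A := _ @^-1` _.
have -> : A = [set x : R | Num.floor (L * x) = z 0 ord0] `*`
    [set t | cell L t = z'].
  rewrite /A !cell_preimage.
  apply/seteqP; split => [[x t] h|[x t] [/= h1 h2] i _] /=.
    split; first by have := h ord0 I.
    by move=> i _ /=; have := h (lift ord0 i) I; rewrite /= tnthS mxE.
  have [j ->|->] := fintype.unliftP ord0 i => //=.
  by rewrite tnthS; have := h2 j I; rewrite /= mxE.
rewrite product_measure1E//; last 2 first.
- exact: measurable_floor.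
- exact: measurable_cell_preimage.
have leb : lebesgue_measure [set x : R | Num.floor (L * x) = z 0 ord0] = L^-1%:E.
  rewrite floor_preimage// lebesgue_measure_itv /= lte_fin ltr_pM2r ?invr_gt0//.
  by rewrite ltr_int ltrDl ltr01 -EFinB -mulrBl intrD addrC addKr mul1r.
by rewrite [X in (X * _)%E]leb ih -EFinM exprS invfM.
Qed.

End lebesgue_cells.

(** * Riemann sums *)

Section riemann_sums.
Context (R : realType) (d : nat).
Local Notation lam := (lebesgue_tuple R d).
Local Notation row_of := (fun t : d.-tuple R => \row_i tnth t i).
Implicit Types (L : R) (H : Zd d -> R).

Lemma cell_sumE L (s : seq (Zd d)) H (t : d.-tuple R) : uniq s ->
  (forall z, H z != 0 -> z \in s) ->
  H (cell L t) = \sum_(z <- s) H z * \1_[set t | cell L t = z] t.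
Proof.
move=> us Hs; have [ts|ts] := boolP (cell L t \in s).
  rewrite (bigD1_seq (cell L t))//= big1 ?addr0 => [|z zt].
    by rewrite indicE mem_set// mulr1.
  by rewrite indicE memNset ?mulr0//= => /esym/eqP; rewrite (negbTE zt).
rewrite big1_seq => [|z /andP[_ zs]].
  by apply/eqP; apply: contraNT ts => /Hs.
rewrite indicE memNset ?mulr0//= => tz.
by move: ts; rewrite tz zs.
Qed.

Lemma integrable_cell L (s : seq (Zd d)) H : 0 < L -> uniq s ->
  (forall z, H z != 0 -> z \in s) ->
  lam.-integrable [set: d.-tuple R] (EFin \o (fun t => H (cell L t))).
Proof.
move=> L0 us Hs; under eq_fun do rewrite (cell_sumE _ _ us Hs).
apply: integrable_EFin_sum => z; apply: integrable_EFin_indic.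
  exact: measurable_cell_preimage.
by rewrite [X in (X < _)%E]lebesgue_cell// ltry.
Qed.

Lemma Rintegral_cell L (s : seq (Zd d)) H : 0 < L -> uniq s ->
  (forall z, H z != 0 -> z \in s) ->
  \int[lam]_t H (cell L t) = L ^- d * \sum_(z <- s) H z.
Proof.
move=> L0 us Hs; under eq_Rintegral do rewrite (cell_sumE _ _ us Hs).
have loo z : (lam [set t | cell L t = z] < +oo)%E.
  by rewrite [X in (X < _)%E]lebesgue_cell// ltry.
rewrite Rintegral_sum; last first.
  by move=> z; apply: integrable_EFin_indic; [exact: measurable_cell_preimage|exact: loo].
rewrite mulr_sumr; apply: eq_bigr => z _.
rewrite Rintegral_indic; [|exact: measurable_cell_preimage|exact: loo].
by rewrite [X in fine X]lebesgue_cell// mulrC.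
Qed.

Lemma cell_dist L (t : d.-tuple R) : 0 < L ->
  `|row_of t - L^-1 *: Zd_to_rV R (cell L t)| <= L^-1.
Proof.
move=> L0; apply/row_norm_le; first by rewrite invr_ge0 ltW.
move=> i; rewrite !mxE.
have /andP[h1 h2] := floor_itv (L * tnth t i).
rewrite -[tnth t i](mulKf (lt0r_neq0 L0)) -mulrBr normrM.
rewrite gtr0_norm ?invr_gt0// -[leRHS]mulr1 ler_pM2l ?invr_gt0//.
rewrite (mulKf (lt0r_neq0 L0)) ler_norml.
by move: h2; rewrite intrD => h2; apply/andP; split; lra.
Qed.

Lemma cell_cvg (L : nat -> R) (t : d.-tuple R) : (forall n, 0 < L n) ->
  L @ \oo --> +oo ->
  (fun n => (L n)^-1 *: Zd_to_rV R (cell (L n) t)) @ \oo --> row_of t.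
Proof.
move=> L0 Loo; apply/cvgrPdist_lt => e e0.
near=> n; apply: le_lt_trans (cell_dist _ (L0 n)) _.
rewrite invf_plt ?posrE//.
by near: n; move/cvgryPgt : Loo; apply.
Unshelve. all: by end_near. Qed.

Lemma measurable_row_of (G : 'rV[R]_d -> R) : continuous G ->
  measurable_fun [set: d.-tuple R] (G \o row_of).
Proof.
move=> cG.
apply: (@measurable_fun_cvg _ _ _ _ (fun n t =>
    G (n.+1%:R^-1 *: Zd_to_rV R (cell n.+1%:R t)))).
  move=> n; apply: (measurableT_comp (f := fun z : Zd d =>
    G (n.+1%:R^-1 *: Zd_to_rV R z)) (g := @cell R d n.+1%:R)) => //.
  exact: measurable_cell.
move=> t _; apply: continuous_cvg; first exact: cG.
apply: (@cell_cvg (fun n => n.+1%:R)) => //.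
have := @cvgr_idn R; rewrite -cvg_shiftS; apply.
Qed.

Lemma scaled_norm L (z : Zd d) : 0 < L -> `|L^-1 *: Zd_to_rV R z| = Zd_norm R z / L.
Proof.
by move=> L0; rewrite normrZ gtr0_norm ?invr_gt0// mulrC.
Qed.

(** Riemann sums of a compactly supported continuous function converge to its
    integral, by dominated convergence applied to step functions. *)
Lemma riemann_sum_cvg (G : 'rV[R]_d -> R) (B : R) (K : nat) (L : nat -> R)
    (W : nat -> nat) :
  continuous G -> (forall v, `|G v| <= B) -> (forall v, G v != 0 -> `|v| <= K%:R) ->
  (forall n, 1 <= L n) -> L @ \oo --> +oo ->
  (forall n, K%:R * L n <= (W n)%:R) ->
  (fun n => L n ^- d * \sum_(z <- zbox d (W n)) G ((L n)^-1 *: Zd_to_rV R z))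
    @ \oo --> \int[lam]_t G (row_of t).
Proof.
move=> cG GB GK L1 Loo LW.
have L0 n : 0 < L n by rewrite (lt_le_trans ltr01).
pose H n z := G ((L n)^-1 *: Zd_to_rV R z).
have Hs n z : H n z != 0 -> z \in zbox d (W n).
  move=> /GK; rewrite scaled_norm// ler_pdivrMr// => h.
  by apply/(@mem_zbox R); exact: le_trans h (LW n).
(* A dominating function: a point whose cell has its corner in the support of
   G is, as L n >= 1, within K + 1 of the origin, hence in a unit cell whose
   corner is within K + 2. *)
pose g := fun z : Zd d => B * (z \in zbox d K.+2)%:R.
have gs z : g z != 0 -> z \in zbox d K.+2.
  by apply: contraNT => zs; rewrite /g (negbTE zs) mulr0.
have ig := @integrable_cell 1 _ g ltr01 (zbox_uniq d K.+2) gs.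
have B0 : 0 <= B by rewrite (le_trans _ (GB 0)).
have Hg n t : `|H n (cell (L n) t)| <= g (cell 1 t).
  have [->|Hn0] := eqVneq (H n (cell (L n) t)) 0.
    by rewrite normr0 mulr_ge0.
  rewrite /g (_ : cell 1 t \in _) ?mulr1 ?GB//.
  apply/(@mem_zbox R).
  have := GK _ Hn0; have := cell_dist t (L0 n); have := cell_dist t (@ltr01 R).
  rewrite invr1 scale1r -/(Zd_norm R _) => h1 h2 h3.
  have h4 : (L n)^-1 <= 1 by rewrite invf_le1.
  have h5 := ler_distD (row_of t) (Zd_to_rV R (cell 1 t))
    ((L n)^-1 *: Zd_to_rV R (cell (L n) t)).
  have h6 := lerB_dist (Zd_to_rV R (cell 1 t))
    ((L n)^-1 *: Zd_to_rV R (cell (L n) t)).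
  rewrite -natr1 -natr1; move: h1 h2 h3 h4 h5 h6.
  rewrite (distrC _ (row_of t)) /Zd_norm; lra.
have iH n : lam.-integrable setT (EFin \o (fun t => H n (cell (L n) t))).
  by apply: (@integrable_cell _ (zbox d (W n))); [exact: L0|exact: zbox_uniq|exact: Hs].
have h1 t : setT t -> (fun n => (H n (cell (L n) t))%:E) @ \oo --> (G (row_of t))%:E.
  move=> _; apply: cvg_EFin; first exact: nearW.
  by apply: continuous_cvg; [exact: cG|exact: cell_cvg].
have h2 t n : setT t -> (`|(H n (cell (L n) t))%:E| <= (g (cell 1 t))%:E)%E.
  by move=> _; rewrite lee_fin.
have mG : measurable_fun [set: d.-tuple R] (EFin \o (G \o row_of)).
  by apply/measurable_EFinP; exact: measurable_row_of.
have -> : (fun n => L n ^- d * \sum_(z <- zbox d (W n)) G ((L n)^-1 *: Zd_to_rV R z)) =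
   (fun n => \int[lam]_t H n (cell (L n) t)).
  apply/funext => n; rewrite (@Rintegral_cell _ (zbox d (W n)))//.
    exact: zbox_uniq.
  exact: Hs.
suff : (fun n => \int[lam]_t (H n (cell (L n) t))%:E)%E @ \oo -->
    (\int[lam]_t G (row_of t))%:E by move=> hc; exact: (fine_cvg hc).
have [iG _ h] := dominated_convergence measurableT (fun n => measurable_int _ (iH n)) mG
  (aeW _ h1) ig (aeW _ h2).
by rewrite fineK//; exact: integrable_fin_num iG.
Qed.

(** A continuous cutoff equal to [1] on the ball of radius [K] and vanishing
    outside the ball of radius [K + 1]. *)
Definition cutoff (K : nat) (v : 'rV[R]_d) : R :=
  Num.max 0 (Num.min 1 (K.+1%:R - `|v|)).

Lemma cutoff_itv K v : 0 <= cutoff K v <= 1.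
Proof.
rewrite /cutoff le_max lexx /= ge_max ler01 /=.
by rewrite ge_min lexx.
Qed.

Lemma cutoff_supp K v : cutoff K v != 0 -> `|v| <= K.+1%:R.
Proof.
apply: contraNT; rewrite -ltNge => h; apply/eqP/max_idPl.
by rewrite ge_min subr_le0 (ltW h) orbT.
Qed.

Lemma cutoff_eq1 K v : `|v| <= K%:R -> cutoff K v = 1.
Proof.
move=> h; rewrite /cutoff (min_idPl _) ?(max_idPr _)//.
by rewrite lerBrDr -natr1 addrC lerD2r.
Qed.

Lemma continuous_cutoff K : continuous (cutoff K).
Proof.
move=> v; rewrite /cutoff.
apply: (@continuous_max _ _ (fun=> 0) (fun v => Num.min 1 (K.+1%:R - `|v|))).
  exact: cst_continuous.
apply: (@continuous_min _ _ (fun=> 1) (fun v => K.+1%:R - `|v|)).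
  exact: cst_continuous.
by apply: continuousB; [exact: cst_continuous|exact: norm_continuous].
Qed.

(** Most of the mass of the probability density [p] is at bounded distance from
    the origin. *)
Lemma cutoff_mass (p : 'rV[R]_d -> R) : continuous p -> (forall v, 0 <= p v) ->
  (\int[lam]_t (p (row_of t))%:E = 1)%E ->
  (fun K => \int[lam]_t (p (row_of t) * cutoff K (row_of t))) @ \oo --> (1 : R).
Proof.
move=> cp p0 p1.
have mp := measurable_row_of cp.
have ip : lam.-integrable setT (EFin \o (p \o row_of)).
  apply/integrableP; split; first exact/measurable_EFinP.
  under eq_integral do rewrite /= ger0_norm//.
  by rewrite p1 ltry.
have mk K : measurable_fun setT (EFin \o (fun t => p (row_of t) * cutoff K (row_of t))).
  apply/measurable_EFinP; apply: measurable_funM => //.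
  exact: (measurable_row_of (@continuous_cutoff K)).
have h1 t : setT t -> (fun K => (p (row_of t) * cutoff K (row_of t))%:E) @ \oo -->
    (p (row_of t))%:E.
  move=> _; apply: cvg_EFin; first exact: nearW.
  apply: cvg_near_cst; near=> K; rewrite /= cutoff_eq1 ?mulr1//.
  by near: K; exact: nbhs_infty_ger.
have h2 t K : setT t ->
    (`|(p (row_of t) * cutoff K (row_of t))%:E| <= (p (row_of t))%:E)%E.
  move=> _; have /andP[c0 c1] := cutoff_itv K (row_of t).
  by rewrite lee_fin normrM !ger0_norm// ler_piMr.
have [_ _ h] := dominated_convergence measurableT mk
  (iffRL (measurable_EFinP _ _) mp) (aeW _ h1) ip (aeW _ h2).
suff : (fun K => \int[lam]_t (p (row_of t) * cutoff K (row_of t))%:E)%E @ \oo -->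
    1%:E by move=> hc; exact: (fine_cvg hc).
by rewrite -p1.
Unshelve. all: by end_near. Qed.

End riemann_sums.

(** * Averaging against a slowly varying weight *)

Section shift_average.
Context (R : realType) (d : nat).

(** Heine's theorem for compactly supported functions. *)
Lemma compact_support_unif_continuous (G : 'rV[R]_d -> R) (r : R) :
  continuous G -> (forall v, G v != 0 -> `|v| <= r) ->
  forall e : R, 0 < e -> exists2 delta : R, 0 < delta &
    forall v w, `|v - w| < delta -> `|G v - G w| < e.
Proof.
move=> cG Gr e e0.
have [r0|r0] := ltP r 0.
  exists 1 => // v w _; suff G0 u : G u = 0 by rewrite !G0 subrr normr0.
  apply/eqP; apply: contraTT r0 => /Gr h.
  by rewrite -leNgt (le_trans _ h).
have cK : compact [set v : 'rV[R]_d | `|v| <= r].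
  have -> : [set v : 'rV[R]_d | `|v| <= r] =
      [set v : 'rV[R]_d | forall i, `[- r, r]%classic (v ord0 i)].
    apply/seteqP; split => v /=; rewrite row_norm_le// => h i; have := h i.
      by rewrite in_itv /= ler_norml.
    by rewrite in_itv /= ler_norml.
  by apply: (@rV_compact _ d (fun=> `[- r, r]%classic)) => i; exact: segment_compact.
have := compact_near_coveringP [set v : 'rV[R]_d | `|v| <= r].
move=> [/(_ cK) hcov _].
have e2 : 0 < e / 2 by rewrite divr_gt0.
have hK : \forall delta \near (0 : R)^'+, [set v : 'rV[R]_d | `|v| <= r] `<=`
    (fun v => forall w, `|v - w| < delta -> `|G v - G w| < e).
  apply: (hcov R (0 : R)^'+
    (fun delta v => forall w, `|v - w| < delta -> `|G v - G w| < e)) => v _.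
  have := cG v; move/cvgrPdist_lt => /(_ _ e2) /nbhs_ballP[rho /= rho0 hrho].
  have rho2 : 0 < rho / 2 by rewrite divr_gt0.
  exists (ball v (rho / 2), [set x | x < rho / 2]) => /=.
    split; first exact: (nbhsx_ballx v _ rho2).
    exact: nbhs_right_lt rho2.
  move=> [v' delta] /= [vv' deltar] w v'w.
  move: vv'; rewrite -ball_normE /= => vv'.
  have h1 : `|G v - G v'| < e / 2.
    apply: hrho; rewrite -ball_normE /=; apply: (lt_trans vv').
    by rewrite ltr_pdivrMr// ltr_pMr// ltr1n.
  have h2 : `|G v - G w| < e / 2.
    apply: hrho; rewrite -ball_normE /=.
    apply: le_lt_trans (ler_distD v' _ _) _.
    by rewrite [ltRHS]splitr ltrD// (lt_trans v'w).
  apply: le_lt_trans (ler_distD (G v) _ _) _.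
  by rewrite [ltRHS]splitr distrC ltrD.
near (0 : R)^'+ => delta.
have delta0 : 0 < delta by [].
have h : [set v : 'rV[R]_d | `|v| <= r] `<=`
    (fun v => forall w, `|v - w| < delta -> `|G v - G w| < e).
  by near: delta; exact: hK.
exists delta => // v w vw.
have [Gv|Gv] := eqVneq (G v) 0; last exact: (h v (Gr _ Gv)).
have [Gw|Gw] := eqVneq (G w) 0; first by rewrite Gv Gw subrr normr0.
by rewrite distrC; apply: (h w (Gr _ Gw)); rewrite distrC.
Unshelve. all: by end_near. Qed.

Lemma sum_const_seq (T : Type) (s : seq T) (c : R) :
  \sum_(z <- s) c = (size s)%:R * c.
Proof. by rewrite big_const_seq count_predT iter_addr_0 mulr_natl. Qed.

Lemma size_zbox_scaled (L : R) (W k : nat) : 1 <= L -> W%:R <= k%:R * L ->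
  L ^- d * (size (zbox d W))%:R <= (k.*2.+1)%:R ^+ d.
Proof.
move=> L1 WL; have L0 : 0 < L by rewrite (lt_le_trans ltr01).
rewrite size_zbox natrX -exprVn -exprMn.
rewrite lerXn2r ?nnegrE ?mulr_ge0 ?invr_ge0 ?(ltW L0)//.
rewrite mulrC ler_pdivrMr// -natr1 -[leRHS]/(_ * L).
have -> : (W.*2)%:R = W%:R * 2 :> R by rewrite -muln2 natrM.
have -> : (k.*2.+1)%:R = k%:R * 2 + 1 :> R by rewrite -natr1 -muln2 natrM.
by move: WL; move: (k%:R) (W%:R : R) => a w WL; lra.
Qed.

(** If the averages of [b] over the translates of [U] are at most [e1], so are
    its averages against the slowly varying weight [G (z / L)]: the weighted
    sum is the mean over [u] in [U] of the sums of
    [G ((z + u) / L) * b (z + u)], and replacing [G ((z + u) / L)] by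
    [G (z / L)] leaves sums of [b] over translates of [U]. *)
Lemma shift_average (G : 'rV[R]_d -> R) (K r : nat) (U : seq (Zd d)) (B e1 : R) :
  continuous G -> (forall v, 0 <= G v) -> (forall v, G v != 0 -> `|v| <= K%:R) ->
  (0 < size U)%N -> (forall u, u \in U -> Zd_norm R u <= r%:R) -> 0 <= B -> 0 <= e1 ->
  forall e2 : R, 0 < e2 -> exists2 L0 : R, 1 <= L0 &
  forall (L : R) (W : nat) (b : Zd d -> R), L0 <= L ->
    K.+1%:R * L <= W%:R -> W%:R <= K.+2%:R * L ->
    (forall z, `|b z| <= B) ->
    (forall k, `|\sum_(u <- U) b (k + u)| <= (size U)%:R * e1) ->
    `|L ^- d * \sum_(z <- zbox d W) G (L^-1 *: Zd_to_rV R z) * b z| <=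
      e1 * (L ^- d * \sum_(z <- zbox d W) G (L^-1 *: Zd_to_rV R z)) + e2.
Proof.
move=> cG G0 GK U0 Ur B0 e10 e2 e20.
pose c0 : R := (K.+2.*2.+1)%:R ^+ d.
have c0gt0 : 0 < c0 by rewrite exprn_gt0.
pose eta := e2 / (c0 * (B + 1)).
have eta0 : 0 < eta by rewrite divr_gt0// mulr_gt0// ltr_wpDl.
have [delta delta0 Gdelta] := compact_support_unif_continuous cG GK eta0.
(* L >= r keeps the translated supports in the box; L > r / delta makes the
   translations by U smaller than delta after scaling. *)
exists (Num.max 1 (Num.max r%:R (r.+1%:R / delta))); first by rewrite le_max lexx.
move=> L W b; rewrite !ge_max => /and3P[L1 Lr Ldelta] LW WL bB bU.
have L0 : 0 < L by rewrite (lt_le_trans ltr01).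
have Ld0 : 0 < L ^- d by rewrite invr_gt0 exprn_gt0.
pose g z := G (L^-1 *: Zd_to_rV R z).
have size_box := size_zbox_scaled L1 WL.
have gK z : g z != 0 -> Zd_norm R z <= K%:R * L.
  by move=> /GK; rewrite scaled_norm// ler_pdivrMr.
have sgb u : u \in U -> \sum_(z <- zbox d W) g (z + u) * b (z + u) =
    \sum_(z <- zbox d W) g z * b z.
  move=> uU; apply: (sum_shift (F := fun z => g z * b z)); first exact: zbox_uniq.
  move=> z; rewrite mulf_eq0 negb_or => /andP[/gK h _].
  have h2 : K%:R * L + L <= W%:R by move: LW; rewrite -natr1 mulrDl mul1r.
  apply/andP; split; apply/(@mem_zbox R).
    by apply: le_trans h2; rewrite (le_trans h)// lerDl ltW.
  have -> : Zd_norm R (z - u) = `|Zd_to_rV R z - Zd_to_rV R u|.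
    by rewrite -[in RHS](subrK u z) Zd_to_rVD addrK.
  apply: le_trans (ler_normB _ _) _; apply: le_trans h2; apply: lerD => //.
  by rewrite (le_trans (Ur u uU)).
have gdist z u : u \in U -> `|g (z + u) - g z| <= eta.
  move=> uU; apply/ltW/Gdelta; rewrite Zd_to_rVD scalerDr addrAC subrr add0r.
  rewrite scaled_norm// ltr_pdivrMr//.
  apply: le_lt_trans (Ur u uU) _; rewrite mulrC -ltr_pdivrMr//.
  by apply: lt_le_trans Ldelta; rewrite ltr_pM2r ?invr_gt0// ltr_nat.
set S := \sum_(z <- zbox d W) G _ * b z.
have SE : (size U)%:R * S =
    \sum_(z <- zbox d W) \sum_(u <- U) (g (z + u) - g z) * b (z + u) +
    \sum_(z <- zbox d W) g z * \sum_(u <- U) b (z + u).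
  rewrite -sum_const_seq -big_split /=.
  under [RHS]eq_bigr do rewrite mulr_sumr -big_split /=.
  rewrite [RHS]exchange_big /=; apply: eq_big_seq => u uU.
  by rewrite -[LHS](sgb u uU); apply: eq_bigr => z _; rewrite mulrBl subrK.
have U0' : 0 < (size U)%:R :> R by rewrite ltr0n.
rewrite normrM gtr0_norm//.
rewrite -(ler_pM2l U0') mulrCA -[X in _ * (X * _)]gtr0_norm// -normrM SE.
have h1 : `|\sum_(z <- zbox d W) \sum_(u <- U) (g (z + u) - g z) * b (z + u)| <=
    (size (zbox d W))%:R * ((size U)%:R * (eta * B)).
  apply: sum_norm_le => z; rewrite -sum_const_seq.
  apply: (le_trans (ler_norm_sum _ _ _)).
  rewrite big_seq [leRHS]big_seq; apply: ler_sum => u uU.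
  by rewrite normrM; apply: ler_pM => //; exact: gdist.
have h2 : `|\sum_(z <- zbox d W) g z * \sum_(u <- U) b (z + u)| <=
    (size U)%:R * e1 * \sum_(z <- zbox d W) g z.
  apply: (le_trans (ler_norm_sum _ _ _)); rewrite mulr_sumr.
  apply: ler_sum => z _; rewrite normrM ger0_norm; last exact: G0.
  by rewrite mulrC ler_wpM2r//; exact: G0.
apply: (@le_trans _ _ (L ^- d * ((size (zbox d W))%:R * ((size U)%:R * (eta * B)) +
   (size U)%:R * e1 * \sum_(z <- zbox d W) g z))).
  by rewrite ler_pM2l//; apply: le_trans (ler_normD _ _) _; exact: lerD.
rewrite mulrDr addrC mulrDr; apply: lerD.
  by rewrite le_eqVlt; apply/orP; left; apply/eqP; rewrite -/g; ring.
have -> : L ^- d * ((size (zbox d W))%:R * ((size U)%:R * (eta * B))) =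
    (size U)%:R * (L ^- d * (size (zbox d W))%:R * (eta * B)) by ring.
rewrite ler_pM2l//.
apply: (@le_trans _ _ (c0 * (eta * B))).
  by rewrite ler_wpM2r// mulr_ge0// ltW.
have B1 : 0 < B + 1 by rewrite ltr_wpDl.
have -> : c0 * (eta * B) = e2 * (B / (B + 1)).
  by rewrite /eta; field; rewrite !gt_eqF.
by rewrite ler_piMr ?(ltW e20)// ler_pdivrMr// mul1r lerDl.
Qed.

End shift_average.

(** * From the local limit theorem to weighted sums *)

Section partition_of_unity.
Context (R : realType) (disp : measure_display) (M : borelMetricType disp R).

(** A continuous partition of unity by functions of small support, indexed by
    the points of a finite net. *)
Lemma partition_of_unity (delta : R) : compact [set: M] -> 0 < delta ->
  exists (s : seq M) (psi : M -> M -> R),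
    [/\ forall x, continuous (psi x), forall x y, 0 <= psi x y <= 1,
        forall y, \sum_(x <- s) psi x y = 1
      & forall x y, psi x y != 0 -> mdist x y < delta].
Proof.
move=> cM delta0; have [s sP] := compact_finite_net cM delta0.
pose g (x y : M) : R := Num.max 0 (delta - mdist x y).
have g0 x y : 0 <= g x y by rewrite /g le_max lexx.
have cg x : continuous (g x : M -> R).
  move=> y; apply: (@continuous_max _ _ (fun=> 0) (fun y => delta - mdist x y)).
    exact: cst_continuous.
  by apply: continuousB; [exact: cst_continuous|exact: mdist_continuous].
pose S (y : M) : R := \sum_(x <- s) g x y.
have cS : continuous S.
  rewrite /S; elim: (s) => [|x s' ih] y.
    by under eq_fun do rewrite big_nil; exact: cst_continuous.
  by under eq_fun do rewrite big_cons; apply: continuousD; [exact: cg|exact: ih].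
have S0 y : 0 < S y.
  have [x xs xy] := sP y; rewrite /S (big_rem x)//=.
  rewrite ltr_pwDl ?sumr_ge0// /g.
  by rewrite lt_max subr_gt0 xy orbT.
exists s, (fun x y => if x \in s then g x y / S y else 0); split.
- move=> x y; case: (x \in s); last exact: cst_continuous.
  apply: continuousM; first exact: cg.
  by apply: continuousV; [rewrite gt_eqF|exact: cS].
- move=> x y; case: ifP => xs; last by rewrite lexx ler01.
  rewrite divr_ge0 ?(ltW (S0 y))//= ler_pdivrMr// mul1r.
  by rewrite /S (big_rem x)//= lerDl sumr_ge0.
- move=> y; rewrite (eq_big_seq (fun x => g x y / S y)) => [|x ->//].
  by rewrite -mulr_suml divff// gt_eqF//; exact: S0.
- move=> x y; case: ifP => [_|_]; last by rewrite eqxx.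
  apply: contraNT; rewrite -leNgt => h.
  by rewrite /g (max_idPl _) ?mul0r// subr_le0.
Qed.

End partition_of_unity.

Section local_limit_estimate.
Context (R : realType) (disp : measure_display) (M : borelMetricType disp R).
Context (d : nat).
Local Notation X := (M * Zd d)%type.

(** The local limit estimates for the finitely many functions of a partition of
    unity turn the integral of [Phi (g y, j + t y)] into a weighted sum of the
    slice averages of [Phi].  Here [g] and [t] stand for an iterate of the map
    and the corresponding Birkhoff sum, [chi] for the cutoff and [q] for the
    limiting density. *)
Lemma local_limit_estimate (nu m : probability M R) (Phi : X -> R) (B : R)
    (g : M -> M) (t : M -> Zd d) (j : Zd d) (L : R)
    (box : seq (Zd d)) (chi q : Zd d -> R) (s : seq M) (psi : M -> M -> R)
    (c0 e1 e2 : R) :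
  measurable_fun [set: X] Phi -> (forall x, `|Phi x| <= B) ->
  measurable_fun [set: M] g -> measurable_fun [set: M] t ->
  0 < L -> uniq box -> (forall z, 0 <= chi z <= 1) ->
  (forall z, chi z != 0 -> z \in box) -> (forall z, 0 <= q z) ->
  L ^- d * (size box)%:R <= c0 ->
  (forall x, measurable_fun [set: M] (psi x)) ->
  (forall x y, 0 <= psi x y <= 1) -> (forall y, \sum_(x <- s) psi x y = 1) ->
  (forall x y k, psi x y != 0 -> `|Phi (x, k) - Phi (y, k)| <= e1) ->
  0 <= e2 ->
  (forall x z, x \in s -> z \in box -> `|L ^+ d * \int[m]_y (psi x (g y) *
      \1_[set y' | t y' = z] y) - q z * \int[nu]_y psi x y| <= e2) ->
  (forall z, z \in box -> `|L ^+ d * \int[m]_y (1 *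
      \1_[set y' | t y' = z] y) - q z| <= e2) ->
  forall S : R, S = L ^- d * \sum_(z <- box) chi z * q z ->
  `|\int[m]_y Phi (g y, j + t y) -
    L ^- d * \sum_(z <- box) chi z * q z * \int[nu]_y Phi (y, j + z)| <=
  B * (`|1 - S| + c0 * e2) + e1 + c0 * ((size s)%:R * B * e2) + e1 * S.
Proof.
move=> mPhi PhiB mg mt L0 ubox chi01 chibox q0 boxc0 mpsi psi01 psi1 psiPhi e20.
move=> hpsi h1 S SE.
have [chi0 chi1] : (forall z, 0 <= chi z) /\ (forall z, chi z <= 1).
  by split => z; have /andP[] := chi01 z.
have B0 : 0 <= B by rewrite (le_trans _ (PhiB (point, j)))//.
have Ld0 : 0 < L ^+ d by rewrite exprn_gt0.
have Ldi0 : 0 < L ^- d by rewrite invr_gt0.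
have ediv (a b e : R) : `|L ^+ d * a - b| <= e -> `|a - L ^- d * b| <= L ^- d * e.
  move=> h; rewrite -[a in `|a - _|](mulKf (lt0r_neq0 Ld0)) -mulrBr normrM gtr0_norm//.
  by rewrite ler_pM2l.
have bPhi k : bounded_measurable (fun y => Phi (y, k)).
  split; last by exists B.
  by apply: measurableT_comp => //; exact: pair2_measurable.
have bPhig : bounded_measurable (fun y => Phi (g y, j + t y)).
  split; last by exists B.
  apply: (measurableT_comp mPhi (g := fun y => (g y, j + t y))).
  apply: measurable_fun_pair => //.
  exact: (measurableT_comp (f := fun z => j + z) _ mt).
have bF (F : Zd d -> R) C : (forall z, `|F z| <= C) -> bounded_measurable (F \o t).
  move=> FC; split; last by exists C => y; exact: FC.
  exact: (measurableT_comp (f := F) _ mt).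
have bchi : bounded_measurable (fun y => chi (t y)).
  by apply: (bF chi 1) => z; rewrite ger0_norm.
have bpsi x : bounded_measurable (psi x).
  by split => //; exists 1 => y; have /andP[h h'] := psi01 x y; rewrite ger0_norm.
have bpsig x : bounded_measurable (fun y => psi x (g y)).
  exact: (bounded_measurable_comp mg (bpsi x)).
have bone : bounded_measurable (fun _ : M => 1 : R) by exact: bounded_measurable_cst.
have bPhix x : bounded_measurable (fun y => Phi (x, j + t y)).
  exact: (bF (fun z => Phi (x, j + z)) B).
have bPsi : bounded_measurable (fun y => \sum_(x <- s) Phi (x, j + t y) * psi x (g y)).
  by apply: bounded_measurable_sum => x; exact: bounded_measurableM.
have approx y k : `|Phi (y, k) - \sum_(x <- s) Phi (x, k) * psi x y| <= e1.
  rewrite -[Phi (y, k)]mulr1 -(psi1 y) mulr_sumr -sumrB.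
  apply: le_trans (ler_norm_sum _ _ _) _.
  rewrite -[leRHS]mulr1 -(psi1 y) mulr_sumr; apply: ler_sum => x _.
  have [->|p0] := eqVneq (psi x y) 0; first by rewrite !mulr0 subrr normr0.
  have /andP[h h'] := psi01 x y.
  by rewrite -mulrBl normrM (ger0_norm h) ler_wpM2r// distrC; exact: psiPhi.
(* The local limit estimate for the constant function 1 shows that the cutoff
   carries mass close to S, hence that the discarded mass is close to 1 - S. *)
have mass : `|\int[m]_y chi (t y) - S| <= c0 * e2.
  have -> : \int[m]_y chi (t y) = \int[m]_y (chi (t y) * 1).
    by apply: eq_Rintegral => y _; rewrite mulr1.
  rewrite (Rintegral_level_sets m mt ubox chibox bone).
  rewrite SE mulr_sumr -sumrB.
  apply: le_trans (ler_norm_sum _ _ _) _.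
  apply: (@le_trans _ _ (\sum_(z <- box) L ^- d * e2)).
    rewrite big_seq [leRHS]big_seq; apply: ler_sum => z zbox.
    rewrite mulrCA -mulrBr normrM ger0_norm//.
    rewrite -[leRHS]mul1r ler_pM//.
    by apply: ediv; exact: h1.
  by rewrite sum_const_seq mulrA (mulrC _%:R) ler_wpM2r.
pose T1 := \int[m]_y (chi (t y) * Phi (g y, j + t y)).
pose T2 := \int[m]_y (chi (t y) * \sum_(x <- s) Phi (x, j + t y) * psi x (g y)).
pose T3 := L ^- d * \sum_(z <- box) chi z * q z *
  \sum_(x <- s) Phi (x, j + z) * \int[nu]_y psi x y.
have d1 : `|\int[m]_y Phi (g y, j + t y) - T1| <= B * (`|1 - S| + c0 * e2).
  apply: (@le_trans _ _ (B * \int[m]_y (1 - chi (t y)))).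
    rewrite -bounded_RintegralB//; last exact: bounded_measurableM.
    apply: le_trans (le_normr_Rintegral _ _) _ => //.
      apply: bounded_measurable_integrable; apply: bounded_measurableB => //.
      exact: bounded_measurableM.
    rewrite -bounded_RintegralZl; last exact: bounded_measurableB.
    apply: le_prob_Rintegral.
    - apply: bounded_measurable_norm; apply: bounded_measurableB => //.
      exact: bounded_measurableM.
    - by apply: bounded_measurableZ; exact: bounded_measurableB.
    - move=> y; rewrite -[X in X - _]mul1r -mulrBl normrM mulrC.
      by rewrite (ger0_norm (_ : 0 <= 1 - chi (t y))) ?subr_ge0// ler_wpM2r ?subr_ge0.
  rewrite ler_wpM2l// bounded_RintegralB// (prob_Rintegral_cst m 1).
  have := ler_norm (1 - S); move: mass; rewrite ler_norml => /andP[].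
  move: (c0 * e2) (\int[m]_y chi (t y)) `|1 - S| => a b D; lra.
have d2 : `|T1 - T2| <= e1.
  apply: prob_Rintegral_dist; [exact: bounded_measurableM..|] => y.
  rewrite -mulrBr normrM ger0_norm// -[leRHS]mul1r ler_pM//.
have d3 : `|T2 - T3| <= c0 * ((size s)%:R * B * e2).
  have -> : T2 = \sum_(x <- s) \sum_(z <- box) chi z * Phi (x, j + z) *
      \int[m]_y (psi x (g y) * \1_[set y' | t y' = z] y).
    rewrite /T2.
    transitivity (\int[m]_y \sum_(x <- s) (chi (t y) * Phi (x, j + t y) * psi x (g y))).
      apply: eq_Rintegral => y _; rewrite mulr_sumr.
      by apply: eq_bigr => x _; rewrite mulrA.
    rewrite bounded_Rintegral_sum => [|x]; last first.
      by apply: bounded_measurableM => //; exact: bounded_measurableM.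
    apply: eq_bigr => x _.
    apply: (@Rintegral_level_sets _ _ _ _ m t box (fun y => psi x (g y))
      (fun z => chi z * Phi (x, j + z))) => // z.
    by rewrite mulf_eq0 negb_or => /andP[/chibox].
  have -> : T3 = \sum_(x <- s) \sum_(z <- box) chi z * Phi (x, j + z) *
      (L ^- d * (q z * \int[nu]_y psi x y)).
    rewrite /T3 mulr_sumr exchange_big /=; apply: eq_bigr => z _.
    by rewrite !mulr_sumr; apply: eq_bigr => x _; ring.
  rewrite -sumrB; apply: le_trans (ler_norm_sum _ _ _) _.
  apply: (@le_trans _ _ (\sum_(x <- s) \sum_(z <- box) B * (L ^- d * e2))).
    rewrite big_seq [leRHS]big_seq; apply: ler_sum => x xs.
    rewrite -sumrB; apply: le_trans (ler_norm_sum _ _ _) _.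
    rewrite big_seq [leRHS]big_seq; apply: ler_sum => z zbox.
    rewrite -mulrBr normrM ler_pM//.
      rewrite normrM -[leRHS]mul1r ler_pM//.
      by rewrite ger0_norm.
    by apply: ediv; exact: hpsi.
  rewrite !sum_const_seq.
  have -> : (size s)%:R * ((size box)%:R * (B * (L ^- d * e2))) =
    L ^- d * (size box)%:R * ((size s)%:R * B * e2) by ring.
  by rewrite ler_wpM2r// !mulr_ge0.
have d4 : `|T3 - L ^- d *
    \sum_(z <- box) chi z * q z * \int[nu]_y Phi (y, j + z)| <= e1 * S.
  rewrite /T3 -mulrBr normrM gtr0_norm// SE mulrCA ler_pM2l//.
  rewrite -sumrB; apply: le_trans (ler_norm_sum _ _ _) _.
  rewrite mulr_sumr; apply: ler_sum => z _.
  rewrite -mulrBr normrM ger0_norm ?mulr_ge0// mulrC ler_wpM2r ?mulr_ge0//.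
  rewrite distrC.
  have -> : \sum_(x <- s) Phi (x, j + z) * \int[nu]_y psi x y =
      \int[nu]_y \sum_(x <- s) Phi (x, j + z) * psi x y.
    rewrite bounded_Rintegral_sum => [|x]; last exact: bounded_measurableZ.
    by apply: eq_bigr => x _; rewrite bounded_RintegralZl.
  apply: prob_Rintegral_dist => //.
  by apply: bounded_measurable_sum => x; exact: bounded_measurableZ.
set I := \int[m]_y Phi (g y, j + t y) in d1 *.
set E := L ^- d * _ in d4 *.
apply: le_trans (ler_distD T1 _ _) _; rewrite -!addrA; apply: lerD => //.
apply: le_trans (ler_distD T2 _ _) _; apply: lerD => //.
by apply: le_trans (ler_distD T3 _ _) _; apply: lerD.
Qed.

End local_limit_estimate.

(** * Averages over cubes *)

Section cube_averages.
Context (R : realType) (disp : measure_display) (M : borelMetricType disp R).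
Context (d : nat).
Local Notation X := (M * Zd d)%type.
Variable nu : probability M R.
Local Notation mu := (nu_counting d nu).

(** The union of the slices with index in [s]. *)
Definition slices (s : seq (Zd d)) : set X := [set x : X | x.2 \in s].

Lemma measurable_slices s : measurable (slices s).
Proof. exact: (@measurable_slice R disp M d [set k | k \in s]). Qed.

Lemma slices_cons (k : Zd d) (s : seq (Zd d)) :
  slices (k :: s) = [set x : X | x.2 = k] `|` slices s.
Proof.
apply/seteqP; split => [x|x [xk|xs]]; rewrite /slices /= in_cons.
- by case/orP => [/eqP|]; [left|right].
- by apply/orP; left; apply/eqP.
- by apply/orP; right.
Qed.

Lemma slices_disj (k : Zd d) (s : seq (Zd d)) : k \notin s ->
  [set x : X | x.2 = k] `&` slices s = set0.
Proof.
move=> ks; apply/seteqP; split => // x [/= xk xs].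
by move: ks; rewrite -xk xs.
Qed.

Lemma counting_Zd1 (k : Zd d) : counting_Zd R [set k] = 1%E.
Proof.
rewrite /counting_Zd /counting asboolT; last exact: finite_set1.
by rewrite fset_set1 finmap.cardfs1.
Qed.

(** On a slice, the reference measure is a copy of [nu]. *)
Lemma nu_counting_slice (k : Zd d) (A : set X) : measurable A ->
  A `<=` [set x : X | x.2 = k] -> mu A = nu [set y | A (y, k)].
Proof.
move=> mA Ak.
have mAk : measurable [set y | A (y, k)].
  by rewrite -[X in measurable X]setTI; exact: (pair2_measurable k).
have -> : A = [set y | A (y, k)] `*` [set k].
  apply/seteqP; split => [[y z] Ayz|[y z] /= [h ->]//].
  by have /= <- := Ak _ Ayz.
transitivity (nu [set y | A (y, k)] * counting_Zd R [set k])%E.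
  exact: product_measure1E.
rewrite counting_Zd1 mule1; congr (nu _).
by apply/seteqP; split => y /=; [move=> h; split|case].
Qed.

Lemma integral_slice (k : Zd d) (F : X -> R) : bounded_measurable F ->
  \int[mu]_(x in [set x : X | x.2 = k]) F x = \int[nu]_y F (y, k).
Proof.
move=> bF; rewrite /Rintegral; congr fine.
have mpk : measurable_fun [set: M] (fun y : M => (y, k)).
  exact: pair2_measurable.
pose pk : {mfun M >-> X} := mfun_Sub (mem_set mpk).
have mk := @measurable_slice R disp M d [set k].
rewrite (eq_measure_integral (pushforward nu pk)); last first.
  by move=> A mA Ak; exact: nu_counting_slice.
rewrite integral_pushforward//.
- by rewrite (_ : _ @^-1` _ = setT)//; apply/seteqP.
- by apply/measurable_EFinP; case: bF.
- have -> : pk @^-1` [set x : X | x.2 = k] = setT by apply/seteqP.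
  have := bounded_measurable_integrable nu (bounded_measurable_comp mpk bF).
  by [].
Qed.

Lemma nu_counting_slices (s : seq (Zd d)) : uniq s -> mu (slices s) = (size s)%:R%:E.
Proof.
elim: s => [_|k s ih /= /andP[ks us]].
  by rewrite (_ : slices [::] = set0) ?measure0//; apply/seteqP; split.
rewrite slices_cons.
have mk := @measurable_slice R disp M d [set k].
rewrite measureU//; last 2 first.
- exact: measurable_slices.
- exact: slices_disj.
have h1 : mu [set x : X | x.2 = k] = 1%E.
  rewrite (@nu_counting_slice k _ mk)// (_ : [set y | _] = setT); last exact/seteqP.
  exact: probability_setT.
by rewrite [X in (X + _)%E]h1 [X in (_ + X)%E](ih us) -EFinD -natr1 addrC.
Qed.

Lemma integral_slices (s : seq (Zd d)) (F : X -> R) : bounded_measurable F -> uniq s ->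
  \int[mu]_(x in slices s) F x = \sum_(k <- s) \int[nu]_y F (y, k).
Proof.
move=> bF; elim: s => [_|k s ih /= /andP[ks us]].
  rewrite (_ : slices [::] = set0) ?Rintegral_set0 ?big_nil//.
  by apply/seteqP; split.
have e := slices_cons k s.
have mk := @measurable_slice R disp M d [set k].
have i : mu.-integrable (slices (k :: s)) (EFin \o F).
  apply: measurable_bounded_integrable.
  - exact: measurable_slices.
  - by rewrite [X in (X < _)%E]nu_counting_slices ?ltry//= ks.
  - by apply: measurable_funTS; case: bF.
  - have [_ [B FB]] := bF; exists B; split; first exact: num_real.
    by move=> C BC x _; exact: le_trans (FB x) (ltW BC).
rewrite big_cons e Rintegral_setU//; last 3 first.
- exact: measurable_slices.
- by rewrite -e.
- by apply/eqP; exact: slices_disj.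
by rewrite ih// integral_slice.
Qed.

(** The displacements from the center to the lattice points of a cube of size
    [w]: their coordinates range over [1 - w./2, ..., w - w./2]. *)
Definition cube_shifts (w : nat) : seq (Zd d) := zgrid d (1 - (w./2)%:Z) w.

Lemma cubeE (z : Zd d) (w : nat) :
  @cube R disp M d z w = slices [seq z + u | u <- cube_shifts w].
Proof.
have hw : (w./2 <= w)%N by lia.
apply/seteqP; split => x; rewrite /cube /slices /=.
  move=> h; apply/mapP; exists (x.2 - z); last by rewrite addrC subrK.
  apply/mem_zgrid => i; have := h i; rewrite !mxE.
  by move: (x.2 0 i) (z 0 i) => a b /andP[h1 h2]; apply/andP; split; lia.
move=> /mapP[u /mem_zgrid uw ->] i; have := uw i; rewrite !mxE.
by move: (u 0 i) (z 0 i) => a b /andP[h1 h2]; apply/andP; split; lia.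
Qed.

Lemma cube_averageE (Phi : X -> R) (z : Zd d) (w : nat) : bounded_measurable Phi ->
  cube_average mu Phi (cube z w) =
  (size (cube_shifts w))%:R^-1 *
    \sum_(u <- cube_shifts w) \int[nu]_y Phi (y, z + u).
Proof.
move=> bPhi; rewrite /cube_average cubeE.
have us : uniq [seq z + u | u <- cube_shifts w].
  by rewrite map_inj_uniq ?zgrid_uniq//; exact: addrI.
rewrite [X in fine X]nu_counting_slices// integral_slices// size_map /=.
by rewrite big_map.
Qed.

(** The averages of the centered slice integrals over the translates of a
    suitable finite set are small. *)
Lemma global_averageP (Phi : X -> R) (Phibar : R) : bounded_measurable Phi ->
  global_average mu Phi Phibar -> forall eps : R, 0 < eps ->
  exists (U : seq (Zd d)) (r : nat), [/\ (0 < size U)%N,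
    forall u, u \in U -> Zd_norm R u <= r%:R &
    forall k, `|\sum_(u <- U) (\int[nu]_y Phi (y, k + u) - Phibar)| <=
      (size U)%:R * eps].
Proof.
move=> bPhi aPhi eps eps0; have [w hw] := aPhi _ eps0.
exists (cube_shifts w.+1), w.+1.
have sU : (0 < size (cube_shifts w.+1))%N by rewrite size_zgrid expn_gt0.
split => // [u /mem_zgrid uU|k].
  apply/Zd_norm_le => i; have /andP[h1 h2] := uU i.
  by rewrite ler_norml; apply/andP; split; lia.
have := hw k w.+1 (ltnSn w); rewrite cube_averageE// => h.
have s0 : 0 < (size (cube_shifts w.+1))%:R :> R by rewrite ltr0n.
rewrite sumrB sum_const_seq.
rewrite -[X in `|X - _|](mulVKf (lt0r_neq0 s0)) -mulrBr normrM gtr0_norm//.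
by rewrite ler_pM2l.
Qed.

End cube_averages.

(** * Uniform local mixing *)

Lemma eventually_seq (T : eqType) (s : seq T) (P : T -> nat -> Prop) :
  (forall x, exists N : nat, forall n, (N <= n)%N -> P x n) ->
  exists N : nat, forall n, (N <= n)%N -> forall x, x \in s -> P x n.
Proof.
move=> h; elim: s => [|x s [N hN]]; first by exists 0.
have [N' hN'] := h x; exists (maxn N N') => n; rewrite geq_max => /andP[n1 n2] y.
by rewrite in_cons => /orP[/eqP->|ys]; [exact: hN'|exact: hN].
Qed.

Section local_mixing.
Context (R : realType) (disp : measure_display) (M : borelMetricType disp R).
Context (d : nat).
Local Notation X := (M * Zd d)%type.
Hypothesis M_compact : compact [set: M].
Variables (nu : probability M R) (f : M -> M) (tau : M -> Zd d).
Hypothesis mf : measurable_fun [set: M] f.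
Hypothesis mtau : measurable_fun [set: M] tau.

(** The local limit theorem for the Birkhoff sums of [tau], with scaling [L] and
    limiting density [p], uniformly over the laws of the class [C]. *)
Definition local_limit (L : nat -> R) (p : 'rV[R]_d -> R)
    (C : set (probability M R)) : Prop :=
  forall phi : M -> R, continuous phi -> forall K eta : R, 0 < eta ->
  exists N : nat, forall m, C m -> forall (z_ : nat -> Zd d) (n : nat),
    (N <= n)%N -> Zd_norm R (z_ n) / L n <= K ->
    `|L n ^+ d *
        \int[m]_y (phi (iter n f y) *
                   \1_[set y' | birkhoff_sum f tau n y' = z_ n] y)
      - p ((L n)^-1 *: Zd_to_rV R (z_ n)) * \int[nu]_y phi y| <= eta.

(** The skew product started from a slice [M x {j}] with a law in [C] averages
    the global observable [Phi] to its mean, uniformly in [j] and in the law. *)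
Lemma local_mixing_uniform (L : nat -> R) (p : 'rV[R]_d -> R)
    (C : set (probability M R)) (Phi : X -> R) (Phibar : R) :
  (forall n, 0 < L n) -> L @ \oo --> +oo -> continuous p ->
  (exists Bp : R, forall v, 0 <= p v <= Bp) ->
  (\int[lebesgue_tuple R d]_t (p (\row_i tnth t i))%:E = 1)%E ->
  local_limit L p C ->
  bounded_function Phi -> unif_continuous (Phi : X -> R^o) ->
  global_average (nu_counting d nu) Phi Phibar ->
  forall e : R, 0 < e -> exists N : nat, forall n, (N <= n)%N ->
    forall m, C m -> forall j : Zd d,
    `|\int[m]_y Phi (iter n f y, j + birkhoff_sum f tau n y) - Phibar| <= e.
Proof.
move=> L0 Loo cp [Bp pB] p1 llt [B' PhiB'] uPhi aPhi e e0.
have p0 v : 0 <= p v by have /andP[] := pB v.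
pose B := `|B'| + `|Phibar| + 1.
have PhiB x : `|Phi x| <= B.
  by rewrite (le_trans (PhiB' x))// (le_trans (ler_norm _))// /B -addrA lerDl addr_ge0.
have PhibarB : `|Phibar| <= B by rewrite /B -addrA addrCA lerDl addr_ge0.
have B0 : 0 < B by rewrite ltr_wpDl// addr_ge0.
have mPhi := unif_continuous_measurable uPhi.
have bPhi : bounded_measurable Phi by split => //; exists B.
(* The error terms below add up to at most (5 B + 7) e1. *)
pose e1 := Num.min (2^-1) (e / (5 * B + 7)).
have B57 : 0 < 5 * B + 7 by rewrite addr_gt0// mulr_gt0.
have e10 : 0 < e1 by rewrite lt_min invr_gt0 ltr0n divr_gt0.
have e1half : e1 <= 2^-1 by rewrite ge_min lexx.
have e1e : (5 * B + 7) * e1 <= e.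
  rewrite mulrC -ler_pdivlMr//.
  by rewrite ge_min lexx orbT.
have [U [r [U0 Ur Uavg]]] := global_averageP bPhi aPhi e10.
have [K Kmass] : exists K, `|1 - \int[lebesgue_tuple R d]_t
    (p (\row_i tnth t i) * cutoff K (\row_i tnth t i))| <= e1.
  have /cvgrPdist_le /(_ _ e10)[K _ hK] := cutoff_mass cp p0 p1.
  by exists K; exact: (hK K (leqnn K)).
pose G v := p v * cutoff K v.
have cG : continuous G.
  by move=> v; apply: continuousM; [exact: cp|exact: continuous_cutoff].
have G0 v : 0 <= G v by rewrite mulr_ge0//; have /andP[] := cutoff_itv K v.
have GK v : G v != 0 -> `|v| <= K.+1%:R.
  by rewrite mulf_eq0 negb_or => /andP[_]; exact: cutoff_supp.
have GB v : `|G v| <= Bp.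
  have /andP[c0 c1] := cutoff_itv K v; have /andP[h1 h2] := pB v.
  by rewrite ger0_norm// (le_trans _ h2)// ler_piMr.
(* W l is the radius of a box between K + 2 and K + 3 times l: it contains the
   support of G scaled by l, with a margin for translations. *)
pose W (l : R) := (Num.truncn (K.+2%:R * l)).+1.
have LW l : 1 <= l -> K.+2%:R * l <= (W l)%:R by move=> _; apply/ltW; exact: truncnS_gt.
have WL l : 1 <= l -> (W l)%:R <= K.+3%:R * l.
  move=> l1; rewrite /W -natr1.
  have -> : K.+3%:R * l = K.+2%:R * l + l by rewrite -[in LHS]natr1 mulrDl mul1r.
  by apply: lerD => //; rewrite truncn_le mulr_ge0// (le_trans ler01).
pose S l := l ^- d * \sum_(z <- zbox d (W l)) G (l^-1 *: Zd_to_rV R z).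
have ScvgN : exists N : nat, forall n, (N <= n)%N ->
    1 <= L n /\ `|1 - S (L n)| <= 2 * e1.
  (* The Riemann sums are controlled for scales at least 1; L is eventually
     such a scale. *)
  pose L' n := Num.max 1 (L n).
  have L'1 n : 1 <= L' n by rewrite le_max lexx.
  have L'oo : L' @ \oo --> +oo.
    apply/cvgryPge => A; move/cvgryPge : Loo => /(_ A); apply: filterS => n An.
    by rewrite le_max An orbT.
  have KL' n : K.+1%:R * L' n <= (W (L' n))%:R.
    apply: le_trans (LW _ (L'1 n)); rewrite ler_wpM2r ?ler_nat//.
    by rewrite (le_trans ler01).
  have := riemann_sum_cvg cG GB GK L'1 L'oo KL'.
  move/cvgrPdist_le => /(_ _ e10)[N1 _ hN1].
  move/cvgryPge : Loo => /(_ 1)[N2 _ hN2].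
  exists (maxn N1 N2) => n; rewrite geq_max => /andP[n1 n2].
  have Ln1 : 1 <= L n by exact: (hN2 n n2).
  split => //; have := hN1 n n1; rewrite /= /L' (max_idPr Ln1) -/(S (L n)) => hS.
  apply: le_trans (ler_distD _ _ _) _; rewrite mulr_natl mulr2n.
  by apply: lerD; [exact: Kmass|exact: hS].
have [N1 hN1] := ScvgN.
have [L1 L11 hshift] := shift_average cG G0 GK U0 Ur
  (ltW (addr_gt0 B0 B0)) (ltW e10) e10.
move: (Loo); move/cvgryPge => /(_ L1)[N2 _ hN2].
have [delta delta0 Phidelta] := unif_continuous_dist uPhi e10.
have [s [psi [cpsi psi01 psi1 psidelta]]] := partition_of_unity M_compact delta0.
pose c0 : R := (K.+3.*2.+1)%:R ^+ d.
have c00 : 0 < c0 by rewrite exprn_gt0.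
(* The tolerance in the local limit theorem: it is summed over a box of at most
   c0 L^d points and over the partition of unity. *)
pose D := c0 * ((size s)%:R * B + 1).
have sB : 0 <= (size s)%:R * B by rewrite mulr_ge0// ltW.
have D0 : 0 < D by rewrite mulr_gt0// ltr_wpDl.
have sB1 : (size s)%:R * B + 1 != 0 by rewrite gt_eqF// ltr_wpDl.
have c0n : c0 != 0 by rewrite gt_eqF.
pose e2 := e1 / D.
have e20 : 0 < e2 by rewrite divr_gt0.
have c0e2 : c0 * e2 <= e1.
  have -> : c0 * e2 = e1 / ((size s)%:R * B + 1).
    by rewrite /e2 /D; field; rewrite sB1 c0n.
  by rewrite ler_pdivrMr ?ltr_wpDl// ler_peMr ?(ltW e10)// lerDr.
have c0sBe2 : c0 * ((size s)%:R * B * e2) <= e1.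
  have -> : c0 * ((size s)%:R * B * e2) = e1 * ((size s)%:R * B / ((size s)%:R * B + 1)).
    by rewrite /e2 /D; field; rewrite sB1 c0n.
  by rewrite ler_piMr ?(ltW e10)// ler_pdivrMr ?ltr_wpDl// mul1r lerDl.
pose P (phi : M -> R) n := forall m, C m -> forall z, Zd_norm R z / L n <= K.+3%:R ->
    `|L n ^+ d * \int[m]_y (phi (iter n f y) *
                   \1_[set y' | birkhoff_sum f tau n y' = z] y)
      - p ((L n)^-1 *: Zd_to_rV R z) * \int[nu]_y phi y| <= e2.
have hP phi : continuous phi -> exists N : nat, forall n, (N <= n)%N -> P phi n.
  move=> cphi; have [N hN] := llt phi cphi K.+3%:R _ e20.
  by exists N => n Nn m Cm z; exact: (hN m Cm (fun=> z)).
have [N3 hN3] := @eventually_seq M s (fun x => P (psi x)) (fun x => hP _ (cpsi x)).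
have [N4 hN4] := hP (cst 1) (@cst_continuous _ _ _).
exists (maxn N1 (maxn N2 (maxn N3 N4))) => n.
rewrite !geq_max => /and4P[n1 n2 n3 n4] m Cm j.
have [Ln1 Sn] := hN1 n n1.
have Ln2 : L1 <= L n by exact: (hN2 n n2).
have inbox z : z \in zbox d (W (L n)) -> Zd_norm R z / L n <= K.+3%:R.
  move=> /(@mem_zbox R) h; rewrite ler_pdivrMr//.
  by apply: le_trans h _; exact: WL.
pose chi (z : Zd d) := cutoff K ((L n)^-1 *: Zd_to_rV R z).
pose q (z : Zd d) := p ((L n)^-1 *: Zd_to_rV R z).
have chibox z : chi z != 0 -> z \in zbox d (W (L n)).
  move=> /cutoff_supp; rewrite scaled_norm// ler_pdivrMr// => h.
  apply/(@mem_zbox R); apply: le_trans h _; apply: le_trans (LW _ Ln1).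
  by rewrite ler_pM2r// ler_nat.
have SnE : S (L n) = L n ^- d * \sum_(z <- zbox d (W (L n))) chi z * q z.
  by rewrite /S; congr (_ * _); apply: eq_bigr => z _; rewrite /G mulrC.
have est := @local_limit_estimate R disp M d nu m Phi B (iter n f)
  (birkhoff_sum f tau n) j (L n) (zbox d (W (L n))) chi q s psi c0 e1 e2
  mPhi PhiB (measurable_iter n mf) (measurable_birkhoff_sum n mf mtau) (L0 n)
  (zbox_uniq d _) (fun z => cutoff_itv K _) chibox (fun z => p0 _)
  (size_zbox_scaled d Ln1 (WL _ Ln1)) (fun x => continuous_measurable_borel (cpsi x))
  psi01 psi1.
have psiPhi x y k : psi x y != 0 -> `|Phi (x, k) - Phi (y, k)| <= e1.
  by move=> /psidelta xy; apply/ltW/Phidelta; rewrite dist_slice.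
have hpsi x z : x \in s -> z \in zbox d (W (L n)) -> `|L n ^+ d *
    \int[m]_y (psi x (iter n f y) * \1_[set y' | birkhoff_sum f tau n y' = z] y) -
    q z * \int[nu]_y psi x y| <= e2.
  by move=> xs zb; exact: (hN3 n n3 x xs m Cm z (inbox z zb)).
have hone z : z \in zbox d (W (L n)) -> `|L n ^+ d *
    \int[m]_y (1 * \1_[set y' | birkhoff_sum f tau n y' = z] y) - q z| <= e2.
  move=> zb; have := hN4 n n4 m Cm z (inbox z zb).
  by rewrite /= (prob_Rintegral_cst nu 1) mulr1.
have {}est := est psiPhi (ltW e20) hpsi hone _ SnE.
pose a k := \int[nu]_y Phi (y, k).
have ab k : `|a k - Phibar| <= B + B.
  apply: le_trans (ler_normB _ _) _; apply: lerD => //.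
  apply: prob_Rintegral_le_norm => [|y]; last exact: PhiB.
  split; last by exists B.
  by apply: measurableT_comp => //; exact: pair2_measurable.
have hb k : `|\sum_(u <- U) (a (j + (k + u)) - Phibar)| <= (size U)%:R * e1.
  by under eq_bigr do rewrite addrA; exact: Uavg.
have hs := hshift (L n) (W (L n)) (fun z => a (j + z) - Phibar) Ln2
  (LW _ Ln1) (WL _ Ln1) (fun z => ab (j + z)) hb.
set E := L n ^- d * \sum_(z <- _) chi z * q z * _ in est.
have EE : E - Phibar * S (L n) = L n ^- d *
    \sum_(z <- zbox d (W (L n))) G ((L n)^-1 *: Zd_to_rV R z) * (a (j + z) - Phibar).
  rewrite /E SnE mulrCA -mulrBr; congr (_ * _).
  rewrite mulr_sumr -sumrB; apply: eq_bigr => z _.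
  by rewrite mulrBr /G /chi /q /a; ring.
set I := \int[m]_y _ in est *.
have d1 : `|I - E| <= B * (2 * e1 + e1) + e1 + e1 + e1 * 2.
  apply: le_trans est _.
  apply: lerD; [apply: lerD => //; apply: lerD => //|].
    by rewrite ler_pM2l// lerD.
  rewrite ler_pM2l//.
  by move: Sn; rewrite ler_norml => /andP[]; lra.
have d2 : `|E - Phibar * S (L n)| <= e1 * 2 + e1.
  rewrite EE; apply: le_trans hs _; rewrite lerD2r ler_pM2l//.
  by move: Sn; rewrite ler_norml => /andP[]; rewrite /S; lra.
have d3 : `|Phibar * S (L n) - Phibar| <= B * (2 * e1).
  rewrite -[X in _ - X]mulr1 -mulrBr normrM ler_pM//.
  by rewrite distrC.
apply: le_trans (ler_distD E _ _) _.
apply: le_trans (lerD d1 (le_trans (ler_distD (Phibar * S (L n)) _ _) (lerD d2 d3))) _.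
apply: le_trans e1e.
by lra.
Qed.

End local_mixing.

(** * Densities and decompositions along slices *)

Section densities.
Context d (T : measurableType d) (R : realType).
Variable m : {measure set T -> \bar R}.

Lemma integrable_mul_bounded (phi F : T -> R) :
  m.-integrable [set: T] (EFin \o phi) -> bounded_measurable F ->
  m.-integrable [set: T] (EFin \o (fun x => phi x * F x)).
Proof.
move=> iphi [mF [B FB]].
have iB : m.-integrable [set: T] (fun x => (B%:E * `|(phi x)%:E|)%E).
  by apply: integrableZl => //; exact: integrable_abse.
apply: (le_integrable measurableT _ _ iB).
  apply/measurable_EFinP; apply: measurable_funM => //.
  by apply/measurable_EFinP; exact: measurable_int iphi.
move=> x _ /=; rewrite lee_fin normrM mulrC.
have B0 : 0 <= B by rewrite (le_trans _ (FB x)).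
by rewrite (@ger0_norm _ (B * _)) ?mulr_ge0// ler_wpM2r.
Qed.

Lemma Rintegral_mul_le (phi F : T -> R) (B : R) :
  m.-integrable [set: T] (EFin \o phi) -> bounded_measurable F ->
  (forall x, `|F x| <= B) ->
  `|\int[m]_x (phi x * F x)| <= B * \int[m]_x `|phi x|.
Proof.
move=> iphi bF FB; have iphiF := integrable_mul_bounded iphi bF.
have in1 : m.-integrable [set: T] (EFin \o (fun x => `|phi x|)).
  exact: (integrable_norm iphi).
apply: le_trans (le_normr_Rintegral measurableT iphiF) _.
rewrite -RintegralZl//; apply: le_Rintegral => //.
- exact: (integrable_norm iphiF).
- by have := integrableZl measurableT B in1; apply.
- by move=> x _; rewrite normrM mulrC ler_wpM2r.
Qed.

(** Integration against a probability with density [phi]; no sign is assumed on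
    [phi], which may be negative on a null set. *)
Lemma Rintegral_density (m' : probability T R) (phi : T -> R) :
  m.-integrable [set: T] (EFin \o phi) ->
  (forall A, measurable A -> m' A = \int[m]_(x in A) (phi x)%:E)%E ->
  forall F, bounded_measurable F -> \int[m']_x F x = \int[m]_x (phi x * F x).
Proof.
move=> iphi m'E; apply: bounded_measurable_ind.
- move=> A mA; rewrite prob_Rintegral_indic// [X in fine X]m'E//.
  rewrite -[LHS]/(\int[m]_(x in A) phi x) Rintegral_mkcond.
  by apply: eq_Rintegral => x _; rewrite patch_indic.
- rewrite (prob_Rintegral_cst m' 0); under eq_Rintegral do rewrite mulr0.
  by rewrite Rintegral_cst// mul0r.
- move=> F G bF bG hF hG; rewrite bounded_RintegralD// hF hG -RintegralD//.
  + by apply: eq_Rintegral => x _; rewrite mulrDr.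
  + exact: integrable_mul_bounded.
  + exact: integrable_mul_bounded.
- move=> c F bF hF; rewrite bounded_RintegralZl// hF -RintegralZl//.
    by apply: eq_Rintegral => x _; rewrite mulrCA.
  exact: integrable_mul_bounded.
- move=> F bF h; apply/eqP; rewrite -subr_eq0 -normr_le0.
  apply/ler_addgt0Pl => e e0; rewrite addr0.
  pose I := \int[m]_x `|phi x|.
  have I0 : 0 <= I by apply: Rintegral_ge0.
  have e1 : 0 < e / (1 + I) by rewrite divr_gt0// ltr_pwDl.
  have [G [bG hG FG]] := h _ e1.
  have d1 := prob_Rintegral_dist m' bF bG FG.
  have d2 : `|\int[m]_x (phi x * F x) - \int[m]_x (phi x * G x)| <= e / (1 + I) * I.
    rewrite -RintegralB//; [|exact: integrable_mul_bounded..].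
    rewrite (_ : \int[m]_x _ = \int[m]_x (phi x * (F x - G x))); last first.
      by apply: eq_Rintegral => x _; rewrite mulrBr.
    by apply: Rintegral_mul_le => //; exact: bounded_measurableB.
  apply: le_trans (ler_distD (\int[m']_x G x) _ _) _.
  rewrite distrC -hG in d2; apply: le_trans (lerD d1 d2) _.
  by rewrite -[X in X + _]mulr1 -mulrDr divfK// gt_eqF// ltr_pwDl.
Qed.

End densities.

(** A law [m] is decomposed along the slices, as a combination of probabilities
    [m' j] and [m'' j] carried by the slice [M x {j}]. *)
Section slice_decomposition.
Context (R : realType) (disp : measure_display) (M : borelMetricType disp R).
Context (d : nat).
Local Notation X := (M * Zd d)%type.
Variables (m : probability X R) (c' c'' : Zd d -> R)
  (m' m'' : Zd d -> probability X R).
Hypothesis c0 : forall j, 0 <= c' j /\ 0 <= c'' j.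
Hypothesis m1 : forall j, m' j ([set: M] `*` [set j]) = 1%E /\
                          m'' j ([set: M] `*` [set j]) = 1%E.
Hypothesis mE : forall A, measurable A -> m A =
  (\esum_(j in [set: Zd d]) ((c' j)%:E * m' j A + (c'' j)%:E * m'' j A))%E.

Lemma prob_slice_null (n : probability X R) (j : Zd d) (A : set X) :
  n ([set: M] `*` [set j]) = 1%E -> measurable A ->
  (forall x, A x -> x.2 != j) -> n A = 0%E.
Proof.
move=> nj mA Aj.
have mj : measurable ([set: M] `*` [set j] : set X) by exact: measurableX.
have : n (~` ([set: M] `*` [set j])) = 0%E.
  by rewrite probability_setC// nj subee.
move=> n0; apply/eqP; rewrite eq_le measure_ge0 andbT -n0.
apply: le_measure; rewrite ?inE//; first exact: measurableC.
by move=> x /Aj h [_ /= xj]; move: h; rewrite xj eqxx.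
Qed.

Lemma prob_slice_restrict (n : probability X R) (j : Zd d) (A : set X) :
  n ([set: M] `*` [set j]) = 1%E -> measurable A ->
  n (A `&` [set x | x.2 = j]) = n A.
Proof.
move=> nj mA; have mj := @measurable_slice R disp M d [set j].
rewrite [RHS](measureDI _ mA mj) [X in (X + _)%E](@prob_slice_null _ j)//; last 2 first.
- exact: measurableD.
- by move=> x [_ /= h]; apply/eqP.
by rewrite add0e.
Qed.

Lemma prob_slice_ae (n : probability X R) (j : Zd d) (F : X -> R) :
  n ([set: M] `*` [set j]) = 1%E -> bounded_measurable F ->
  \int[n]_x F x = \int[n]_x F (x.1, j).
Proof.
move=> nj bF; have [mF [B FB]] := bF.
have bFj : bounded_measurable (fun x : X => F (x.1, j)).
  split; last by exists B.
  apply: (measurableT_comp mF (g := fun x : X => (x.1, j))).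
  exact: measurable_fun_pair.
apply/eqP; rewrite -subr_eq0 -bounded_RintegralB// -normr_le0.
have mj : measurable [set x : X | x.2 != j].
  exact: (@measurable_slice R disp M d [set k | k != j]).
apply: (@le_trans _ _ (\int[n]_x ((B + B) * \1_[set x : X | x.2 != j] x))).
  apply: le_trans (le_normr_Rintegral measurableT _) _.
    by apply: bounded_measurable_integrable; exact: bounded_measurableB.
  apply: le_prob_Rintegral.
  - by apply: bounded_measurable_norm; exact: bounded_measurableB.
  - by apply: bounded_measurableZ; exact: bounded_measurable_indic.
  - move=> x; rewrite indicE; case: x => y k.
    have [->|kj] := eqVneq k j.
      by rewrite subrr normr0 mulr_ge0// addr_ge0// (le_trans _ (FB (y, j))).
    rewrite mem_set// mulr1; apply: le_trans (ler_normB _ _) _.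
    exact: lerD.
rewrite bounded_RintegralZl; last exact: bounded_measurable_indic.
by rewrite prob_Rintegral_indic// [X in fine X](@prob_slice_null _ j)//= mulr0.
Qed.

Lemma decomposition_slice (k : Zd d) (A : set X) : measurable A ->
  m (A `&` [set x | x.2 = k]) = ((c' k)%:E * m' k A + (c'' k)%:E * m'' k A)%E.
Proof.
move=> mA; have mk := @measurable_slice R disp M d [set k].
have mAk : measurable (A `&` [set x | x.2 = k]) by exact: measurableI.
rewrite mE// (esumID [set k])//; last first.
  move=> j _; have [h1 h2] := c0 j.
  by rewrite adde_ge0// mule_ge0// ?lee_fin// measure_ge0.
rewrite !setTI [X in (_ + X)%E]esum1 ?adde0.
  rewrite esum_set1; last first.
    by have [h1 h2] := c0 k; rewrite adde_ge0// mule_ge0// ?lee_fin// measure_ge0.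
  have [h1 h2] := m1 k.
  rewrite [X in (_ * X + _)%E](prob_slice_restrict h1)//.
  by rewrite [X in (_ + _ * X)%E](prob_slice_restrict h2).
move=> j /= jk; have [h1 h2] := m1 j.
have hj x : (A `&` [set x | x.2 = k]) x -> x.2 != j.
  by move=> [_ /= ->]; apply/eqP => kj; apply: jk.
rewrite [X in (_ * X + _)%E](prob_slice_null h1)//.
by rewrite [X in (_ + _ * X)%E](prob_slice_null h2)// !mule0 adde0.
Qed.

Lemma integral_decomposition_slice (k : Zd d) (F : X -> R) : bounded_measurable F ->
  \int[m]_x (F x * slice_indic k x) =
  c' k * \int[m' k]_x F x + c'' k * \int[m'' k]_x F x.
Proof.
have mk := @measurable_slice R disp M d [set k].
have bk : bounded_measurable (slice_indic k : X -> R).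
  by rewrite slice_indicE; exact: bounded_measurable_indic.
have [c'0 c''0] := c0 k.
move: F; apply: bounded_measurable_ind.
- move=> A mA.
  rewrite (_ : \int[m]_x _ = \int[m]_x \1_(A `&` [set x | x.2 = k]) x); last first.
    by apply: eq_Rintegral => x _; rewrite slice_indicE indicI.
  rewrite !prob_Rintegral_indic//; last exact: measurableI.
  rewrite [X in fine X](decomposition_slice k mA) fineD ?fineM//.
  + by rewrite fin_num_measure.
  + by rewrite fin_num_measure.
  + by rewrite fin_numM// fin_num_measure.
  + by rewrite fin_numM// fin_num_measure.
- rewrite !(prob_Rintegral_cst _ 0) !mulr0 addr0.
  by under eq_Rintegral do rewrite mul0r; exact: (prob_Rintegral_cst m 0).
- move=> F G bF bG hF hG; rewrite !bounded_RintegralD//.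
  under eq_Rintegral do rewrite mulrDl.
  rewrite bounded_RintegralD; [|exact: bounded_measurableM..].
  by rewrite hF hG; ring.
- move=> c F bF hF; rewrite !bounded_RintegralZl//.
  under eq_Rintegral do rewrite -mulrA.
  rewrite bounded_RintegralZl; last exact: bounded_measurableM.
  by rewrite hF; ring.
- move=> F bF h; apply/eqP; rewrite -subr_eq0 -normr_le0.
  apply/ler_addgt0Pl => e e0; rewrite addr0.
  have e1 : 0 < e / (1 + (c' k + c'' k)) by rewrite divr_gt0// ltr_pwDl// addr_ge0.
  have [G [bG hG FG]] := h _ e1.
  set e2 := e / _ in e1 FG.
  have d0 : `|\int[m]_x (F x * slice_indic k x) -
      \int[m]_x (G x * slice_indic k x)| <= e2.
    apply: prob_Rintegral_dist; [exact: bounded_measurableM..|] => x.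
    rewrite -mulrBl normrM; apply: le_trans (FG x); rewrite ler_piMr//.
    by rewrite /slice_indic; case: (_ == _); rewrite ?normr1 ?normr0.
  have d1 := prob_Rintegral_dist (m' k) bF bG FG.
  have d2 := prob_Rintegral_dist (m'' k) bF bG FG.
  have -> : e = e2 + (c' k * e2 + c'' k * e2).
    by rewrite /e2; field; rewrite gt_eqF// ltr_pwDl// addr_ge0.
  apply: le_trans (ler_distD (\int[m]_x (G x * slice_indic k x)) _ _) _.
  apply: lerD => //; rewrite hG.
  rewrite opprD addrACA -!mulrBr; apply: le_trans (ler_normD _ _) _.
  by rewrite !normrM !(ger0_norm c'0) !(ger0_norm c''0) lerD// ler_wpM2l// distrC.
Qed.

End slice_decomposition.

Section slice_decomposition_bound.
Context (R : realType) (disp : measure_display) (M : borelMetricType disp R).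
Context (d : nat).
Local Notation X := (M * Zd d)%type.

Lemma prob_box_exhaust (m : probability X R) (eta : R) : 0 < eta ->
  exists W : nat, 1 - fine (m (slices (zbox d W))) <= eta.
Proof.
move=> eta0.
have cvg_m : m \o (fun n => slices (zbox d n) : set X) @ \oo --> 1%E.
  rewrite -(probability_setT m).
  have <- : \bigcup_n (slices (zbox d n) : set X) = setT.
    apply/seteqP; split => // x _.
    exists (Num.truncn (Zd_norm R x.2)).+1 => //.
    by apply/(@mem_zbox R)/ltW; exact: truncnS_gt.
  apply: nondecreasing_cvg_mu.
  - by move=> n; exact: measurable_slices.
  - by apply: bigcup_measurable => n _; exact: measurable_slices.
  - move=> n1 n2 n12; apply/subsetPset => x /(@mem_zbox R) h.
    by apply/(@mem_zbox R); apply: le_trans h _; rewrite ler_nat.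
have : fine \o (m \o (fun n => slices (zbox d n) : set X)) @ \oo --> (1 : R).
  exact: fine_cvg.
move=> /cvgrPdist_le /(_ _ eta0)[W _ hW].
exists W; apply: le_trans (hW W (leqnn W)).
exact: ler_norm.
Qed.

Lemma sum_le_esum (a : Zd d -> R) (s : seq (Zd d)) (c : R) : uniq s ->
  (forall k, 0 <= a k) -> (\esum_(j in [set: Zd d]) (a j)%:E <= c%:E)%E ->
  \sum_(k <- s) a k <= c.
Proof.
move=> us a0 h; rewrite -lee_fin; apply: le_trans h; apply: esum_ge.
exists [set` s]; first by split => //; exact: finite_seq.
by rewrite -fsbig_seq//= sumEFin.
Qed.

Lemma slices_sum (s : seq (Zd d)) (F : X -> R) x : uniq s ->
  F x * \1_(slices s) x = \sum_(k <- s) F x * slice_indic k x.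
Proof.
move=> us; rewrite -mulr_sumr; congr (_ * _); rewrite indicE.
have [xs|xs] := boolP (x.2 \in s).
  rewrite mem_set// (bigD1_seq x.2)//= /slice_indic eqxx big1 ?addr0// => k.
  by rewrite eq_sym => /negbTE ->.
rewrite memNset; last by move=> h; rewrite h in xs.
rewrite big1_seq// => k /andP[_ ks]; rewrite /slice_indic.
by case: eqP => // xk; move: xs; rewrite xk ks.
Qed.

(** If the integrals of [F] against the [m' j] are at most [e] and the weights of
    the [m'' j] add up to at most [Ce], the integral of [F] against the whole
    law is at most [e] plus [Ce] times the supremum of [F]. *)
Lemma decomposition_bound (m : probability X R) (c' c'' : Zd d -> R)
    (m' m'' : Zd d -> probability X R) (F : X -> R) (D e Ce : R) :
  (forall j, 0 <= c' j /\ 0 <= c'' j) ->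
  (forall j, m' j ([set: M] `*` [set j]) = 1%E /\
             m'' j ([set: M] `*` [set j]) = 1%E) ->
  (forall A, measurable A -> m A =
    (\esum_(j in [set: Zd d]) ((c' j)%:E * m' j A + (c'' j)%:E * m'' j A))%E) ->
  bounded_measurable F -> (forall x, `|F x| <= D) -> 0 <= e ->
  (forall j, `|\int[m' j]_x F x| <= e) ->
  (\esum_(j in [set: Zd d]) (c'' j)%:E <= Ce%:E)%E ->
  `|\int[m]_x F x| <= e + D * Ce.
Proof.
move=> c0 m1 mE bF FD e0 Fe cCe.
have D0 : 0 <= D by rewrite (le_trans _ (FD point)).
have bk k : bounded_measurable (slice_indic k : X -> R).
  rewrite slice_indicE; apply: bounded_measurable_indic.
  exact: (@measurable_slice R disp M d [set k]).
have bs s : bounded_measurable (\1_(slices s) : X -> R).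
  by apply: bounded_measurable_indic; exact: measurable_slices.
have sumE G s : bounded_measurable G -> uniq s ->
    \int[m]_x (G x * \1_(slices s) x) =
    \sum_(k <- s) (c' k * \int[m' k]_x G x + c'' k * \int[m'' k]_x G x).
  move=> bG us; under eq_Rintegral do rewrite slices_sum//.
  rewrite bounded_Rintegral_sum => [|k]; last exact: bounded_measurableM.
  by apply: eq_bigr => k _; exact: (integral_decomposition_slice c0 m1 mE).
apply/ler_addgt0Pl => eta eta0.
have eta1 : 0 < eta / (1 + D) by rewrite divr_gt0// ltr_pwDl.
have [W hW] := prob_box_exhaust m eta1.
set s := zbox d W in hW; have us : uniq s := zbox_uniq d W.
have massE : fine (m (slices s)) = \sum_(k <- s) (c' k + c'' k).
  rewrite -prob_Rintegral_indic; last exact: measurable_slices.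
  transitivity (\int[m]_x (1 * \1_(slices s) x)).
    by apply: eq_Rintegral => x _; rewrite mul1r.
  rewrite (sumE (cst 1) s (bounded_measurable_cst _ 1) us).
  by apply: eq_bigr => k _; rewrite !(prob_Rintegral_cst _ 1) !mulr1.
have sc'' : \sum_(k <- s) c'' k <= Ce.
  by apply: sum_le_esum => // k; have [] := c0 k.
have sc' : \sum_(k <- s) c' k <= 1.
  have : \sum_(k <- s) (c' k + c'' k) <= 1.
    rewrite -massE -lee_fin fineK ?fin_num_measure//; last exact: measurable_slices.
    by apply: probability_le1; exact: measurable_slices.
  apply: le_trans; apply: ler_sum => k _; rewrite lerDl.
  by have [] := c0 k.
have d1 : `|\int[m]_x (F x * \1_(slices s) x)| <= e + D * Ce.
  rewrite sumE//; apply: le_trans (ler_norm_sum _ _ _) _.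
  apply: (@le_trans _ _ (\sum_(k <- s) (e * c' k + D * c'' k))).
    apply: ler_sum => k _; have [h1 h2] := c0 k.
    apply: le_trans (ler_normD _ _) _; rewrite !normrM (ger0_norm h1) (ger0_norm h2).
    rewrite mulrC (mulrC (c'' k)); apply: lerD; apply: ler_wpM2r => //.
    exact: prob_Rintegral_le_norm.
  rewrite big_split/= -!mulr_sumr; apply: lerD.
    by rewrite ler_piMr.
  by rewrite ler_wpM2l.
have d2 : `|\int[m]_x F x - \int[m]_x (F x * \1_(slices s) x)| <= eta.
  apply: (@le_trans _ _ (\int[m]_x (D * (1 - \1_(slices s) x)))).
    rewrite -bounded_RintegralB//; last exact: bounded_measurableM.
    apply: le_trans (le_normr_Rintegral measurableT _) _.
      apply: bounded_measurable_integrable; apply: bounded_measurableB => //.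
      exact: bounded_measurableM.
    apply: le_prob_Rintegral.
    - apply: bounded_measurable_norm; apply: bounded_measurableB => //.
      exact: bounded_measurableM.
    - apply: bounded_measurableZ; apply: bounded_measurableB => //.
      exact: (bounded_measurable_cst _ 1).
    - move=> x; rewrite -[X in X - _]mulr1 -mulrBr normrM.
      have i1 : 0 <= 1 - \1_(slices s) x :> R.
        by rewrite indicE; case: (_ \in _); rewrite ?subrr ?subr0.
      by rewrite (ger0_norm i1) ler_wpM2r.
  have b1 : bounded_measurable (cst 1 : X -> R) by exact: bounded_measurable_cst.
  rewrite bounded_RintegralZl; last exact: bounded_measurableB.
  rewrite bounded_RintegralB// (prob_Rintegral_cst m 1).
  rewrite prob_Rintegral_indic; last exact: measurable_slices.
  apply: (@le_trans _ _ (D * (eta / (1 + D)))); first by rewrite ler_wpM2l.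
  by rewrite mulrCA ler_piMr ?(ltW eta0)// ler_pdivrMr ?ltr_pwDl// mul1r lerDr.
rewrite -[X in `|X|](subrK (\int[m]_x (F x * \1_(slices s) x))).
by apply: le_trans (ler_normD _ _) _; exact: lerD.
Qed.

End slice_decomposition_bound.

(** * Mixing for the laws of the class *)

Section class_mixing.
Context (R : realType) (disp : measure_display) (M : borelMetricType disp R).
Context (d : nat).
Local Notation X := (M * Zd d)%type.
Variables (Tt : X -> X) (MM : set (probability X R)).
Hypothesis mTt : measurable_fun [set: X] Tt.
Hypothesis M1 : forall m, MM m -> in_class MM (pushforward m Tt).

(** The class is stable under the dynamics, up to values on non-measurable
    sets. *)
Lemma class_iter m n : MM m -> exists2 mn, MM mn &
  forall A, measurable A -> mn A = pushforward m (iter n Tt) A.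
Proof.
move=> MMm; elim: n => [|n [mn MMmn mnE]]; first by exists m.
have [m' MMm' m'E] := M1 MMmn; exists m' => // A mA.
rewrite m'E// /pushforward mnE//.
by rewrite -[X in measurable X]setTI; exact: mTt.
Qed.

(** Integrals of a global observable along the orbit of a law in the class
    converge to its mean. *)
Lemma class_mixing (f : M -> M) (nu : probability M R) (tau : M -> Zd d)
    (MMeps : R -> set (probability M R)) (L : nat -> R) (p : 'rV[R]_d -> R)
    (Phi : X -> R) (Phibar : R) (m : probability X R) (C : R) :
  compact [set: M] -> measurable_fun [set: M] f -> measurable_fun [set: M] tau ->
  (forall (eps : R) (n : nat), 0 < eps -> exists2 r : R, 0 < r &
    forall m, MM m ->
      (m [set x | (r <= Zd_norm R x.2 /\
                   eps <= mdist (iter n (skew_product f tau) x)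
                                (iter n Tt x))%R] <= eps%:E)%E) ->
  (forall n, 0 < L n) -> L @ \oo --> +oo -> continuous p ->
  (exists Bp : R, forall v, 0 <= p v <= Bp) ->
  (\int[lebesgue_tuple R d]_t (p (\row_i tnth t i))%:E = 1)%E ->
  (forall eps : R, 0 < eps -> local_limit nu f tau L p (MMeps eps)) ->
  (forall eps : R, 0 < eps ->
    exists n0 : nat, forall n : nat, (n0 <= n)%N ->
    exists (c' c'' : Zd d -> R) (m' m'' : Zd d -> probability X R),
      [/\ forall j, 0 <= c' j /\ 0 <= c'' j,
          forall j, m' j ([set: M] `*` [set j]) = 1%E /\
                    m'' j ([set: M] `*` [set j]) = 1%E,
          forall A, measurable A ->
            pushforward m (iter n Tt) A =
            (\esum_(j in [set: Zd d])
               ((c' j)%:E * m' j A + (c'' j)%:E * m'' j A))%E,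
          forall j, in_class (MMeps eps) (pushforward (m' j) fst)
        & (\esum_(j in [set: Zd d]) (c'' j)%:E <= (C * eps)%:E)%E]) ->
  (forall r : R, 0 < r ->
    (fun n => m [set x | Zd_norm R (iter n Tt x).2 <= r]) @ \oo --> 0%E) ->
  MM m -> bounded_function Phi -> unif_continuous (Phi : X -> R^o) ->
  global_average (nu_counting d nu) Phi Phibar ->
  (fun n => \int[m]_x Phi (iter n Tt x)) @ \oo --> Phibar.
Proof.
move=> cM mf mtau M3 L0 Loo cp pB p1 M4 M5 M6 MMm bdPhi uPhi aPhi.
have mPhi := unif_continuous_measurable uPhi.
have bPhi : bounded_measurable Phi by split.
have [B' PhiB'] := bdPhi.
pose B := `|B'| + `|Phibar| + 1.
have PhiB x : `|Phi x| <= B.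
  by rewrite (le_trans (PhiB' x))// (le_trans (ler_norm _))// /B -addrA lerDl addr_ge0.
have PhibarB : `|Phibar| <= B by rewrite /B -addrA addrCA lerDl addr_ge0.
have B0 : 0 < B by rewrite ltr_wpDl// addr_ge0.
apply/cvgrPdist_le => e e0.
pose e1 := e / 5.
have e10 : 0 < e1 by rewrite divr_gt0.
(* With this tolerance, the exceptional part of the decomposition weighs at
   most e1 / (2 B). *)
pose e5 := e1 / (2 * B * (`|C| + 1)).
have e50 : 0 < e5 by rewrite divr_gt0// !mulr_gt0// ltr_wpDl.
have Ce5 : 2 * B * (C * e5) <= e1.
  apply: (@le_trans _ _ (2 * B * (`|C| * e5))).
    by rewrite ler_pM2l ?mulr_gt0// ler_pM2r// ler_norm.
  have -> : 2 * B * (`|C| * e5) = e1 * (`|C| / (`|C| + 1)).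
    by rewrite /e5; field; rewrite !gt_eqF// ltr_wpDl.
  by rewrite ler_piMr ?(ltW e10)// ler_pdivrMr ?ltr_wpDl// mul1r lerDl.
have [n0 hn0] := M5 _ e50.
have [q hq] := local_mixing_uniform cM mf mtau L0 Loo cp pB p1 (M4 _ e50)
  bdPhi uPhi aPhi e10.
have {hq}hq := hq q (leqnn q).
have [delta delta0 Phidelta] := unif_continuous_dist uPhi e10.
pose e3 := Num.min delta (e1 / (2 * B)).
have e30 : 0 < e3 by rewrite lt_min delta0 divr_gt0// mulr_gt0.
have e3B : 2 * B * e3 <= e1.
  by rewrite mulrC -ler_pdivlMr ?mulr_gt0// ge_min lexx orbT.
have [r r0 hr] := M3 e3 q e30.
have e60 : 0 < e1 / (2 * B) by rewrite divr_gt0// mulr_gt0.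
have mnear n : measurable [set x : X | Zd_norm R (iter n Tt x).2 <= r].
  have := measurable_iter n mTt measurableT
    (@measurable_slice R disp M d [set k | Zd_norm R k <= r]).
  by rewrite setTI.
have [N6 hN6] : exists N6 : nat, forall n, (N6 <= n)%N ->
    fine (m [set x | Zd_norm R (iter n Tt x).2 <= r]) <= e1 / (2 * B).
  have : fine \o (fun n => m [set x | Zd_norm R (iter n Tt x).2 <= r]) @ \oo --> (0 : R).
    by apply: fine_cvg; exact: M6.
  move=> /cvgrPdist_le /(_ _ e60)[N6 _ hN6]; exists N6 => n n6.
  have := hN6 n n6; rewrite /= sub0r normrN; apply: le_trans.
  exact: ler_norm.
exists (q + maxn n0 N6)%N => // n /= nq.
pose N := (n - q)%N.
have qn : (q <= n)%N by exact: leq_trans (leq_addr _ _) nq.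
have nE : n = (q + N)%N by rewrite /N subnKC.
have Nn0 : (n0 <= N)%N.
  by rewrite /N leq_subRL// (leq_trans _ nq)// leq_add2l leq_maxl.
have NN6 : (N6 <= N)%N.
  by rewrite /N leq_subRL// (leq_trans _ nq)// leq_add2l leq_maxr.
have [mN MMmN mNE] := class_iter N MMm.
pose Tq := iter q (skew_product f tau).
have mT : measurable_fun [set: X] (skew_product f tau).
  have -> : skew_product f tau = iter 1 (skew_product f tau) by [].
  rewrite (_ : iter 1 _ = fun x => (f x.1, x.2 + birkhoff_sum f tau 1 x.1)); last first.
    by apply/funext => x; rewrite iter_skew_product.
  apply: measurable_fun_slices => k; apply: measurable_fun_pair => //.
  apply: (measurableT_comp (f := fun z => k + z) _ (measurable_birkhoff_sum 1 mf mtau)).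
  by [].
have mTq : measurable_fun [set: X] Tq by exact: measurable_iter.
have mTtq : measurable_fun [set: X] (iter q Tt) by exact: measurable_iter.
have bI : bounded_measurable (Phi \o iter q Tt) by exact: bounded_measurable_comp.
have bJ : bounded_measurable (Phi \o Tq) by exact: bounded_measurable_comp.
have IE : \int[m]_x Phi (iter n Tt x) = \int[mN]_x Phi (iter q Tt x).
  rewrite (bounded_Rintegral_pushforward (measurable_iter N mTt) mNE bI).
  by apply: eq_Rintegral => x _; rewrite nE iterD.
(* Outside A1 (near the origin) and A2 (where the two dynamics separate within
   q steps), the integrands differ by at most e1. *)
pose A1 := [set x : X | Zd_norm R x.2 <= r].
pose A2 := [set x : X | (r <= Zd_norm R x.2 /\ e3 <= mdist (Tq x) (iter q Tt x))%R].
have mA1 : measurable A1 by exact: (mnear 0).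
have mA2 : measurable A2.
  have -> : A2 = [set x : X | r <= Zd_norm R x.2] `&`
      [set x | e3 <= mdist (Tq x) (iter q Tt x)] by [].
  apply: measurableI; last exact: measurable_mdist_ge.
  exact: (@measurable_slice R disp M d [set k | r <= Zd_norm R k]).
have b1 : bounded_measurable (\1_A1 : X -> R) by exact: bounded_measurable_indic.
have b2 : bounded_measurable (\1_A2 : X -> R) by exact: bounded_measurable_indic.
have d1 : `|\int[mN]_x Phi (iter q Tt x) - \int[mN]_x Phi (Tq x)| <= e1 + e1 + e1.
  rewrite -bounded_RintegralB//.
  apply: le_trans (le_normr_Rintegral measurableT _) _.
    by apply: bounded_measurable_integrable; exact: bounded_measurableB.
  apply: (@le_trans _ _ (\int[mN]_x (e1 + 2 * B * \1_A1 x + 2 * B * \1_A2 x))).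
    apply: le_prob_Rintegral.
    - by apply: bounded_measurable_norm; exact: bounded_measurableB.
    - apply: bounded_measurableD; last exact: bounded_measurableZ.
      by apply: bounded_measurableD; [exact: bounded_measurable_cst|exact: bounded_measurableZ].
    - move=> x.
      have i1 : 0 <= 2 * B * \1_A1 x by rewrite !mulr_ge0// ltW.
      have i2 : 0 <= 2 * B * \1_A2 x by rewrite !mulr_ge0// ltW.
      have tB : `|Phi (iter q Tt x) - Phi (Tq x)| <= 2 * B.
        apply: le_trans (ler_normB _ _) _; rewrite mulr_natl mulr2n.
        by apply: lerD; exact: PhiB.
      have [x1|x1] := pselect (A1 x).
        have -> : \1_A1 x = 1 :> R by rewrite indicE mem_set.
        move: i2 tB; rewrite mulr1.
        by move: (_ * \1_A2 x) => a; lra.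
      have [x2|x2] := pselect (A2 x).
        have -> : \1_A2 x = 1 :> R by rewrite indicE mem_set.
        move: i1 tB; rewrite mulr1.
        by move: (_ * \1_A1 x) => a; lra.
      apply: (@le_trans _ _ e1); last first.
        by move: i1 i2; move: (_ * \1_A1 x) (_ * \1_A2 x) => a b; lra.
      rewrite distrC; apply/ltW/Phidelta; rewrite ltNge; apply/negP => h.
      apply: x2; split; first by apply/ltW; rewrite ltNge; apply/negP.
      by apply: le_trans h; rewrite ge_min lexx.
  rewrite bounded_RintegralD; last 2 first.
  - by apply: bounded_measurableD; [exact: bounded_measurable_cst|exact: bounded_measurableZ].
  - exact: bounded_measurableZ.
  rewrite bounded_RintegralD; last 2 first.
  - exact: bounded_measurable_cst.
  - exact: bounded_measurableZ.
  rewrite (prob_Rintegral_cst mN e1) !bounded_RintegralZl// !prob_Rintegral_indic//.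
  apply: lerD; first apply: lerD => //.
    rewrite mulrC -ler_pdivlMr ?mulr_gt0// [X in fine X]mNE//.
    exact: hN6.
  apply: le_trans e3B; rewrite ler_pM2l ?mulr_gt0//.
  rewrite -lee_fin fineK ?fin_num_measure//; exact: hr.
have [c' [c'' [m' [m'' [c0 m1 mE clm cC]]]]] := hn0 N Nn0.
have mNE' A : measurable A -> mN A = (\esum_(j in [set: Zd d])
               ((c' j)%:E * m' j A + (c'' j)%:E * m'' j A))%E.
  by move=> mA; rewrite mNE// mE.
pose F x := Phi (Tq x) - Phibar.
have bF : bounded_measurable F.
  by apply: bounded_measurableB => //; exact: bounded_measurable_cst.
have FB x : `|F x| <= 2 * B.
  apply: le_trans (ler_normB _ _) _; rewrite mulr_natl mulr2n.
  by apply: lerD; [exact: PhiB|exact: PhibarB].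
have Fe j : `|\int[m' j]_x F x| <= e1.
  have [m1j _] := m1 j.
  rewrite (prob_slice_ae m1j bF).
  have [nj Cnj njE] := clm j.
  have bFj : bounded_measurable (fun y => F (y, j)).
    have [mF [BF FBF]] := bF; split; last by exists BF.
    by apply: measurableT_comp => //; exact: pair2_measurable.
  rewrite -(@bounded_Rintegral_pushforward _ _ _ _ _ (m' j) nj fst (fun y => F (y, j)))//.
  have bP : bounded_measurable (fun y => Phi (iter q f y, j + birkhoff_sum f tau q y)).
    have [mP [BF FBF]] := bJ; split; last first.
      by exists BF => y; have := FBF (y, j); rewrite /= /Tq iter_skew_product.
    have := measurableT_comp mP (pair2_measurable j).
    by congr (measurable_fun _ _); apply/funext => y; rewrite /= /Tq iter_skew_product.
  have -> : \int[nj]_y F (y, j) =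
      \int[nj]_y Phi (iter q f y, j + birkhoff_sum f tau q y) - Phibar.
    rewrite -[in RHS](prob_Rintegral_cst nj Phibar) -bounded_RintegralB//; last first.
      exact: bounded_measurable_cst.
    by apply: eq_Rintegral => y _; rewrite /F /Tq iter_skew_product.
  exact: hq.
have d2 : `|\int[mN]_x F x| <= e1 + 2 * B * (C * e5).
  exact: (decomposition_bound c0 m1 mNE' bF FB (ltW e10) Fe cC).
have FE : \int[mN]_x F x = \int[mN]_x Phi (Tq x) - Phibar.
  rewrite bounded_RintegralB ?(prob_Rintegral_cst mN Phibar)//.
  exact: bounded_measurable_cst.
rewrite distrC IE; apply: le_trans (ler_distD (\int[mN]_x Phi (Tq x)) _ _) _.
rewrite -FE; apply: le_trans (lerD d1 d2) _.
have -> : e = 5 * e1 by rewrite /e1 mulrC divfK.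
by move: Ce5; move: (2 * B * _) => a; lra.
Qed.

End class_mixing.

(** * Local observables *)

Section local_observables.
Context (R : realType) (disp : measure_display) (M : borelMetricType disp R).
Context (d : nat).
Local Notation X := (M * Zd d)%type.

(** Distinct slices are at distance at least [1]. *)
Lemma mdist_lt1_snd (x y : X) : mdist x y < 1 -> x.2 = y.2.
Proof.
rewrite [mdist x y]/(Num.max (mdist x.1 y.1) (x.2 != y.2)%:R) gt_max => /andP[_].
by case: eqVneq => //; rewrite ltxx.
Qed.

Lemma compact_Zd_bounded (S : set X) : compact S ->
  exists n : nat, forall x, S x -> Zd_norm R x.2 <= n%:R.
Proof.
move=> cS; have [/(_ cS) hcov _] := compact_near_coveringP S.
have hS : \forall n \near \oo, S `<=` (fun x => Zd_norm R x.2 <= n%:R).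
  apply: (hcov nat \oo (fun n x => Zd_norm R x.2 <= n%:R)) => x _.
  exists (ball x 1, [set n | Zd_norm R x.2 <= n%:R]) => /=.
    split; first exact: (nbhsx_ballx x _ ltr01).
    exact: nbhs_infty_ger.
  by move=> [x' n] /= []; rewrite ballEmdist /= => /mdist_lt1_snd <-.
by have [n _ hn] := hS; exists n => x; exact: (hn n (leqnn n)).
Qed.

Lemma positive_density_ae (mu m : {measure set X -> \bar R}) (h : X -> R)
    (P : X -> Prop) : positive_density mu m h ->
  {ae mu, forall x, P x} -> {ae m, forall x, P x}.
Proof.
move=> [mh h0 mE] [A [mA muA PA]]; exists A; split => //.
rewrite mE// null_set_integral//.
exact/measurable_EFinP/measurable_funTS.
Qed.

(** The integral of an essentially small function supported on a set of finite
    measure. *)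
Lemma ess_bound_integral (mu m : {measure set X -> \bar R}) (h : X -> R)
    (u : X -> R) (S : set X) (e : R) :
  positive_density mu m h -> (0 < mu [set: X])%E ->
  ('N[mu]_+oo [EFin \o u] <= e%:E)%E -> measurable_fun [set: X] u ->
  measurable S -> (m S < +oo)%E -> (forall x, ~ S x -> u x = 0) -> 0 <= e ->
  \int[m]_x `|u x| <= e * fine (m S).
Proof.
move=> hd mu0 ue mu_ mS mSoo uS e0.
have aeu : {ae m, forall x, (`|u x|%:E <= e%:E)%E}.
  apply: (positive_density_ae hd); move: ue.
  by rewrite unlock mu0 => /ess_supP.
have iS := integrable_EFin_indic e mS mSoo.
have h1 : (\int[m]_x `|u x|%:E <= \int[m]_x (e * \1_S x)%:E)%E.
  apply: ae_ge0_le_integral => //.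
  - by apply/measurable_EFinP; exact: measurableT_comp.
  - by move=> x _; rewrite lee_fin mulr_ge0.
  - exact: measurable_int iS.
  - apply: filterS aeu => x ux _.
    have [Sx|Sx] := pselect (S x); first by rewrite indicE mem_set// mulr1.
    by rewrite uS// normr0 lee_fin mulr_ge0.
have iS' : (\int[m]_x (e * \1_S x)%:E)%E \is a fin_num.
  exact: integrable_fin_num iS.
rewrite -Rintegral_indic//; apply: fine_le => //.
rewrite ge0_fin_numE; last by apply: integral_ge0 => x _; rewrite lee_fin.
by apply: le_lt_trans h1 _; move: iS'; rewrite fin_numElt => /andP[].
Qed.

End local_observables.

Theorem theorem2p13 (R : realType) (d : nat) (d_gt0 : (0 < d)%N)
  (disp : measure_display) (M : borelMetricType disp R)
  (M_compact : compact [set: M])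
  (f : M -> M) (nu : probability M R) (f_nu : preserves nu f)
  (tau : M -> Zd d) (tau_meas : measurable_fun [set: M] tau)
  (Tt : M * Zd d -> M * Zd d)
  (mut : {measure set (M * Zd d) -> \bar R})
  (Tt_mut : preserves mut Tt)
  (mut_bounded : finite_on_bounded mut)
  (h : M * Zd d -> R)
  (h_density : positive_density (nu_counting d nu) mut h)
  (h_slow : slowly_varying h)
  (MM : set (probability (M * Zd d)%type R))
  (MMeps : R -> set (probability M R))
  (M1 : forall m, MM m -> in_class MM (pushforward m Tt))
  (M2 : forall phi : M * Zd d -> R,
    lipschitz_fun phi -> compact (support_closure phi) ->
    forall eps : R, 0 < eps ->
    exists (k : nat) (phis : 'I_k -> M * Zd d -> R) (c : 'I_k -> R),
      (forall j,
        [/\ phis j \in Lfun (nu_counting d nu) +oo%E,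
            mut.-integrable [set: M * Zd d] (EFin \o phis j),
            forall x, phis j x != 0 ->
              unit_neighborhood (support_closure phi) x
          & in_class MM (fun A => (\int[mut]_(x in A) (phis j x)%:E)%E)]) /\
      ('N[nu_counting d nu]_+oo
         [EFin \o (fun x => phi x - \sum_(j < k) c j * phis j x)%R]
         <= eps%:E)%E)
  (M3 : forall (eps : R) (n : nat), 0 < eps -> exists2 r : R, 0 < r &
    forall m, MM m ->
      (m [set x | (r <= Zd_norm R x.2 /\
                   eps <= mdist (iter n (skew_product f tau) x)
                                (iter n Tt x))%R]
         <= eps%:E)%E)
  (M4 : exists (L : nat -> R) (p : 'rV[R]_d -> R),
    [/\ (forall n, 0 < L n) /\ L @ \oo --> +oo,
        continuous p,
        exists B : R, forall v, 0 <= p v <= B,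
        (\int[lebesgue_tuple R d]_t (p (\row_i tnth t i))%:E = 1)%E
      & forall eps : R, 0 < eps ->
        forall phi : M -> R, continuous phi ->
        forall K eta : R, 0 < eta ->
        exists N : nat, forall m, MMeps eps m ->
        forall (z_ : nat -> Zd d) (n : nat),
          (N <= n)%N -> Zd_norm R (z_ n) / L n <= K ->
          `|L n ^+ d *
              \int[m]_y (phi (iter n f y) *
                         \1_[set y' | birkhoff_sum f tau n y' = z_ n] y)
            - p ((L n)^-1 *: Zd_to_rV R (z_ n)) * \int[nu]_y phi y| <= eta])
  (M5 : exists C : R, forall m, MM m -> forall eps : R, 0 < eps ->
    exists n0 : nat, forall n : nat, (n0 <= n)%N ->
    exists (c' c'' : Zd d -> R)
           (m' m'' : Zd d -> probability (M * Zd d)%type R),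
      [/\ forall j, 0 <= c' j /\ 0 <= c'' j,
          forall j, m' j ([set: M] `*` [set j]) = 1%E /\
                    m'' j ([set: M] `*` [set j]) = 1%E,
          forall A, measurable A ->
            pushforward m (iter n Tt) A =
            (\esum_(j in [set: Zd d])
               ((c' j)%:E * m' j A + (c'' j)%:E * m'' j A))%E,
          forall j, in_class (MMeps eps) (pushforward (m' j) fst)
        & (\esum_(j in [set: Zd d]) (c'' j)%:E <= (C * eps)%:E)%E])
  (M6 : forall m, MM m -> forall r : R, 0 < r ->
    (fun n => m [set x | Zd_norm R (iter n Tt x).2 <= r]) @ \oo --> 0%E) :
  local_global_mixing (nu_counting d nu) mut Tt.
Proof.
move=> phi Phi Phibar iphi [bdPhi uPhi _] aPhi.
have [mTt _] := Tt_mut; have [mf _] := f_nu.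
have [L [p [[L0 Loo] cp pB p1 llt]]] := M4.
have [C decomp] := M5.
have mixing m : MM m -> (fun n => \int[m]_x Phi (iter n Tt x)) @ \oo --> Phibar.
  move=> MMm; apply: (class_mixing mTt M1 M_compact mf tau_meas M3 L0 Loo cp pB p1
    llt (decomp m MMm) (M6 m MMm) MMm bdPhi uPhi aPhi).
have mPhi := unif_continuous_measurable uPhi.
have [B' PhiB'] := bdPhi.
pose B := `|B'| + `|Phibar| + 1.
have B0 : 0 < B by rewrite ltr_wpDl// addr_ge0.
have PhiB x : `|Phi x| <= B.
  by rewrite (le_trans (PhiB' x))// (le_trans (ler_norm _))// /B -addrA lerDl addr_ge0.
have PhibarB : `|Phibar| <= B by rewrite /B -addrA addrCA lerDl addr_ge0.
pose F n x := Phi (iter n Tt x) - Phibar.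
have bPhin n : bounded_measurable (fun x => Phi (iter n Tt x)).
  split; last by exists B.
  exact: measurableT_comp mPhi (measurable_iter n mTt).
have bF n : bounded_measurable (F n).
  by apply: bounded_measurableB => //; exact: bounded_measurable_cst.
have FB n x : `|F n x| <= 2 * B.
  apply: le_trans (ler_normB _ _) _; rewrite mulr_natl mulr2n.
  by apply: lerD; [exact: PhiB|exact: PhibarB].
have FE n u : mut.-integrable setT (EFin \o u) ->
    \int[mut]_x (u x * F n x) =
    \int[mut]_x (u x * Phi (iter n Tt x)) - (\int[mut]_x u x) * Phibar.
  move=> iu; rewrite -RintegralZr// -RintegralB//.
  - by apply: eq_Rintegral => x _; rewrite mulrBr.
  - exact: integrable_mul_bounded.
  - exact: (integrable_mul_bounded iu (bounded_measurable_cst _ Phibar)).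
apply/cvgrPdist_le => e e0.
pose e1 := e / (3 * (2 * B)).
have e10 : 0 < e1 by rewrite divr_gt0// !mulr_gt0.
have [_ /(_ _ e10)[psi [lpsi cpsi ipsi phipsi]]] :=
  lipschitz_dense M_compact mut_bounded iphi.
have [r hr] := compact_Zd_bounded cpsi.
pose S : set (M * Zd d) := [set x | Zd_norm R x.2 <= r%:R].
have mS : measurable S := @measurable_slice R disp M d [set k | Zd_norm R k <= r%:R].
have mutS : (mut S < +oo)%E by apply: mut_bounded => //; exists r%:R.
pose V := fine (mut S); have V0 : 0 <= V by exact: fine_ge0.
pose e2 := e1 / (V + 1).
have e20 : 0 < e2 by rewrite divr_gt0// ltr_wpDl.
(* The supports of the phis j lie in unit neighborhoods of that of psi, which
   meet the same slices; hence psi and chi vanish outside S. *)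
have [k [phis [c [hphis hN]]]] := M2 psi lpsi cpsi e2 e20.
have iphis j : mut.-integrable setT (EFin \o phis j) by have [] := hphis j.
pose chi x := \sum_(j < k) c j * phis j x.
have ichi : mut.-integrable setT (EFin \o chi).
  apply: integrable_EFin_sum => j.
  by have := integrableZl measurableT (c j) (iphis j); apply.
pose u x := psi x - chi x.
have iu : mut.-integrable setT (EFin \o u).
  by have := integrableB measurableT ipsi ichi; apply.
have mu_gt0 : (0 < nu_counting d nu [set: M * Zd d])%E.
  apply: (@lt_le_trans _ _ (nu_counting d nu (slices [:: 0]))).
    by rewrite [X in (_ < X)%E]nu_counting_slices// lte_fin.
  by apply: le_measure; rewrite ?inE//; exact: measurable_slices.
have u_small : \int[mut]_x `|u x| <= e1.
  apply: (@le_trans _ _ (e2 * V)).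
    apply: (ess_bound_integral h_density mu_gt0 hN _ mS mutS _ (ltW e20)).
      by apply/measurable_EFinP; exact: measurable_int iu.
    move=> x Sx; rewrite /u /chi.
    have psi0 y : y.2 = x.2 -> ~ support_closure psi y.
      by move=> yx /hr; rewrite yx; exact: Sx.
    have -> : psi x = 0.
      apply/eqP; apply: contrapT => /negP px; apply: (psi0 x erefl).
      exact: subset_closure.
    rewrite big1 ?subr0// => j _; have [_ _ suppj _] := hphis j.
    have [->|pj] := eqVneq (phis j x) 0; first by rewrite mulr0.
    by have [y Sy /mdist_lt1_snd xy] := suppj x pj; case: (psi0 y).
  by rewrite /e2 mulrAC ler_pdivrMr ?ltr_wpDl// ler_pM2l// lerDl.
have phipsi_small : \int[mut]_x `|phi x - psi x| <= e1.
  rewrite -lee_fin fineK//.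
  exact: integrable_fin_num (integrable_dist iphi ipsi).
have e3 : 0 < e / 3 by rewrite divr_gt0.
have chi_cvg : (fun n => \int[mut]_x (chi x * F n x)) @ \oo --> (0 : R).
  have -> : (fun n => \int[mut]_x (chi x * F n x)) =
      (fun n => \sum_(j < k) c j * \int[mut]_x (phis j x * F n x)).
    apply/funext => n.
    transitivity (\int[mut]_x (\sum_(j < k) c j * (phis j x * F n x))).
      apply: eq_Rintegral => x _; rewrite /chi mulr_suml.
      by apply: eq_bigr => j _; rewrite mulrA.
    have iphiF j := integrable_mul_bounded (iphis j) (bF n).
    rewrite Rintegral_sum => [|j]; last first.
      by have := integrableZl measurableT (c j) (iphiF j); apply.
    by apply: eq_bigr => j _; rewrite RintegralZl.
  suff : (fun n => \sum_(j < k) c j * \int[mut]_x (phis j x * F n x)) @ \oo -->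
      (\sum_(j < k) c j * 0 : R).
    by rewrite [X in _ --> X]big1// => j _; rewrite mulr0.
  apply: cvg_big => [|j _]; first exact: add_continuous.
  apply: cvgMr.
  have [_ _ _ [m MMm mE]] := hphis j.
  have -> : (fun n => \int[mut]_x (phis j x * F n x)) =
      (fun n => \int[m]_x Phi (iter n Tt x) - Phibar).
    apply/funext => n.
    rewrite -(Rintegral_density (iphis j) mE (bF n)).
    rewrite bounded_RintegralB ?(prob_Rintegral_cst m Phibar)//.
    exact: bounded_measurable_cst.
  by apply/subr_cvg0; exact: mixing.
move/cvgrPdist_le : chi_cvg => /(_ _ e3); apply: filterS => n.
rewrite sub0r normrN => chin.
rewrite distrC -FE//.
have split_phi : \int[mut]_x (phi x * F n x) =
    \int[mut]_x ((phi x - psi x) * F n x) + \int[mut]_x (u x * F n x) +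
    \int[mut]_x (chi x * F n x).
  have iphipsi : mut.-integrable setT (EFin \o (fun x => phi x - psi x)).
    by have := integrableB measurableT iphi ipsi; apply.
  have i1 := integrable_mul_bounded iphipsi (bF n).
  have i2 := integrable_mul_bounded iu (bF n).
  rewrite -RintegralD// -RintegralD//.
  - by apply: eq_Rintegral => x _; rewrite /u; ring.
  - by have := integrableD measurableT i1 i2; apply.
  - exact: integrable_mul_bounded.
have d1 : `|\int[mut]_x ((phi x - psi x) * F n x)| <= e / 3.
  have iphipsi : mut.-integrable setT (EFin \o (fun x => phi x - psi x)).
    by have := integrableB measurableT iphi ipsi; apply.
  apply: le_trans (Rintegral_mul_le iphipsi (bF n) (FB n)) _.
  apply: (@le_trans _ _ (2 * B * e1)); first by rewrite ler_pM2l// mulr_gt0.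
  by rewrite le_eqVlt; apply/orP; left; apply/eqP; rewrite /e1; field; rewrite gt_eqF.
have d2 : `|\int[mut]_x (u x * F n x)| <= e / 3.
  apply: le_trans (Rintegral_mul_le iu (bF n) (FB n)) _.
  apply: (@le_trans _ _ (2 * B * e1)); first by rewrite ler_pM2l// mulr_gt0.
  by rewrite le_eqVlt; apply/orP; left; apply/eqP; rewrite /e1; field; rewrite gt_eqF.
rewrite split_phi.
have -> : e = e / 3 + e / 3 + e / 3 by field.
apply: le_trans (ler_normD _ _) _; apply: lerD => //.
by apply: le_trans (ler_normD _ _) _; exact: lerD.
Qed.
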